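(* Let $f\in C^2(\mathbb{R}^d)$ with $\inf f>-\infty$, let $\gamma:\mathbb{R}_+\to\mathbb{R}_+$ be continuous with $c\le\gamma(t)\le C$ for all $t\ge0$ ($0<c\le C$), and let $0<\beta<\frac{2c}{C^2}$. Consider $$\ddot x(t)+\gamma(t)\dot x(t)+\nabla f(x(t)+\beta\dot x(t))=0,\ t>0,\qquad x(0)=x_0,\ \dot x(0)=v_0. \tag{ISIHD}$$ Then: (i) there exists a global solution $x\in C^2(\mathbb{R}_+;\mathbb{R}^d)$ of (ISIHD); (ii) $\dot x\in L^2(\mathbb{R}_+;\mathbb{R}^d)$ and $\nabla f\circ(x+\beta\dot x)\in L^2(\mathbb{R}_+;\mathbb{R}^d)$; (iii) if $x$ is bounded on $\mathbb{R}_+$, then $\nabla f\circ x\in L^2(\mathbb{R}_+;\mathbb{R}^d)$, $\lim_{t\to\infty}\|\nabla f(x(t))\|=\lim_{t\to\infty}\|\dot x(t)\|=0$, and $\lim_{t\to\infty}f(x(t))$ exists; (iv) if in addition to (iii) $f$ is definable, then $\dot x\in L^1(\mathbb{R}_+;\mathbb{R}^d)$ and $x(t)$ converges as $t\to+\infty$ to a critical point of $f$.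
   Context: Definable: definable in an o-minimal structure over $\mathbb{R}$. Critical point: $u$ with $\nabla f(u)=0$. *)

(* Defs.v *)
From HB Require Import structures.
From mathcomp Require Import all_boot all_order all_algebra.
From mathcomp Require Import all_classical all_reals all_analysis.
Set Implicit Arguments. Unset Strict Implicit. Unset Printing Implicit Defensive.
Import Order.TTheory GRing.Theory Num.Theory.
Import numFieldNormedType.Exports.
Local Open Scope classical_set_scope.
Local Open Scope ring_scope.

Section Defs.
Variable R : realType.

Definition evec (d : nat) (i : 'I_d) : 'rV[R]_d := delta_mx 0 i.

Definition enorm (d : nat) (v : 'rV[R]_d) : R := Num.sqrt (\sum_i v 0 i ^+ 2).

Definition pd (d : nat) (g : 'rV[R]_d -> R) (i : 'I_d) (u : 'rV[R]_d) : R :=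
  derive1 (fun h : R => g (u + h *: evec i)) 0.

Definition has_pd (d : nat) (g : 'rV[R]_d -> R) (i : 'I_d) (u : 'rV[R]_d) :=
  derivable (fun h : R => g (u + h *: evec i)) 0 1.

Definition grad (d : nat) (g : 'rV[R]_d -> R) (u : 'rV[R]_d) : 'rV[R]_d :=
  \row_i pd g i u.

Definition C2 (d : nat) (f : 'rV[R]_d -> R) :=
  [/\ continuous f,
      (forall i u, has_pd f i u),
      (forall i, continuous (pd f i)),
      (forall i j u, has_pd (pd f i) j u) &
      (forall i j, continuous (pd (pd f i) j))].

Definition critical (d : nat) (f : 'rV[R]_d -> R) (u : 'rV[R]_d) := grad f u = 0.

Definition vel (d : nat) (x : R -> 'rV[R]_d) (t : R) : 'rV[R]_d :=
  \row_i derive1 (fun s => x s 0 i) t.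
Definition acc (d : nat) (x : R -> 'rV[R]_d) (t : R) : 'rV[R]_d :=
  \row_i derive1 (derive1 (fun s => x s 0 i)) t.

(* x is C^2 (componentwise twice continuously differentiable).  A C^2 curve on
   [0,+oo) is represented by a C^2 curve on R (any C^2 curve on [0,+oo) extends). *)
Definition C2curve (d : nat) (x : R -> 'rV[R]_d) :=
  forall i : 'I_d,
  [/\ (forall t, derivable (fun s => x s 0 i) t 1),
      (forall t, derivable (derive1 (fun s => x s 0 i)) t 1) &
      continuous (derive1 (derive1 (fun s => x s 0 i)))].

Definition Rplus : set R := [set t | 0 <= t].

Definition Lp_Rplus (d : nat) (p : nat) (g : R -> 'rV[R]_d) :=
  (forall i, measurable_fun Rplus (fun t => g t 0 i)) /\
  (\int[@lebesgue_measure R]_(t in Rplus) ((enorm (g t)) ^+ p)%:E < +oo)%E.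

Definition ISIHD_solution (d : nat) (f : 'rV[R]_d -> R) (gamma : R -> R)
    (beta : R) (x0 v0 : 'rV[R]_d) (x : R -> 'rV[R]_d) :=
  [/\ C2curve x,
      (forall t, 0 < t ->
         acc x t + gamma t *: vel x t + grad f (x t + beta *: vel x t) = 0),
      x 0 = x0 & vel x 0 = v0].

(* ---------- o-minimal structures over R (Coste's definition) ---------- *)
Inductive pterm (n : nat) : Type :=
  | PVar of 'I_n
  | PConst of R
  | PAdd of pterm n & pterm n
  | PMul of pterm n & pterm n.

Fixpoint peval (n : nat) (p : pterm n) (v : 'rV[R]_n) : R :=
  match p with
  | PVar i => v 0 i
  | PConst c => c
  | PAdd p q => peval p v + peval q v
  | PMul p q => peval p v * peval q v
  end.

Definition algebraic_set (n : nat) (A : set 'rV[R]_n) :=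
  exists ps : seq (pterm n), A = [set v | all (fun p => peval p v == 0) ps].

Definition o_minimal_structure (S : forall n : nat, set (set 'rV[R]_n)) :=
  [/\ (forall n A, algebraic_set A -> S n A),
      (forall n, S n set0) /\
      ((forall n A B, S n A -> S n B -> S n (A `|` B)) /\
       (forall n A, S n A -> S n (~` A))),
      (forall m n A B, S m A -> S n B ->
         S (m + n)%N [set v | exists2 a, A a & exists2 b, B b & v = row_mx a b]),
      (forall n A, S (n + 1)%N A -> S n [set lsubmx v | v in A]) &
      (forall A, S 1%N A <->
         exists s : seq (interval R), A = [set v | has (fun I => v 0 0 \in I) s])].

Definition definable (d : nat) (f : 'rV[R]_d -> R) :=
  exists S, o_minimal_structure S /\
    S (d + 1)%N [set v | exists u, v = row_mx u (const_mx (f u) : 'rV[R]_1)].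

End Defs.

(* Main.v *)
Require Import Defs.
From HB Require Import structures.
From mathcomp Require Import all_boot all_order all_algebra.
From mathcomp Require Import all_classical all_reals all_analysis.
From mathcomp Require Import measurable_realfun ring lra.
Set Implicit Arguments. Unset Strict Implicit. Unset Printing Implicit Defensive.
Import Order.TTheory GRing.Theory Num.Theory.
Import numFieldNormedType.Exports.
Local Open Scope classical_set_scope.
Local Open Scope ring_scope.

(** Put E(u, w) = f(u) + |w|^2 / 2 and z = (x + beta x', x').  Along a solution
    (E o z)' = - beta |g|^2 - beta gamma <g, x'> - gamma |x'|^2 with
    g = grad f (x + beta x'), and beta gamma < 2 makes this at most
    - k |grad E (z)|^2 for some k > 0.  As E is bounded below, x' and g are square
    integrable, and x' is bounded.  The last fact keeps x + beta x' in a box that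
    grows with time; truncating grad f outside this box gives an equation with a
    globally Lipschitz right-hand side, whose Picard iterates converge on the
    whole line, and its solution never feels the truncation.  If x is bounded,
    |grad E (z)|^2 is Lipschitz with bounded primitive, so it tends to 0.

    For definable f, select definably a point c(s) minimising |grad E| on the part
    of the level {E = s} in a large ball (successive minimisation of |grad E| and
    of the coordinates).  Definable functions of one variable are monotone near a
    point: near 0+ all points have the same sign pattern of g(y) - g(x) to their
    left and right, and a function on an interval cannot have a strict local
    extremum at every point, since those form a countable set.  So the total
    variation psi of c is finite, and s - s' <= (|grad E (c(s))| + e) (psi(s) - psi(s'))
    for s' < s close to s; neither continuity nor differentiability of c is needed,
    because a jump of c only makes psi(s) - psi(s') larger.  Hence
    psi(E(z) - lim E(z)) + (k / 8) int |x'| has nonpositive right Dini derivative,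
    and x has finite length. *)

(** * Primitives and derivatives on the line *)

(** Along a solution f itself need not decrease, hence the passage to E on R^(2d). The curve z is
    not a gradient curve of E, but x' is a block of grad E (z), so |x'| <= |grad E (z)|: a decay of
    the energy quadratic in |grad E (z)|, set against a Kurdyka inequality linear in it, bounds the
    length of x. The bound k comes from completing a square coordinate by coordinate. The
    desingularising function is the variation of a curve, and not a reparametrised derivative,
    because the monotone germs are drawn from the axioms of o-minimality by counting alone; the
    price is a Dini derivative in place of a chain rule. The norm of row vectors is the maximum
    norm, so balls are boxes and are cut out by polynomial inequalities; [enorm] is the Euclidean
    norm. *)

Section Calculus.
Variable R : realType.

Lemma continuous_distP (V W : normedModType R) (g : V -> W) (x : V) :
  {for x, continuous g} <-> forall e : R, 0 < e ->
    exists2 dl : R, 0 < dl & forall y, `|y - x| < dl -> `|g y - g x| < e.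
Proof.
split => [cg e e0|H].
  have /cvgrPdist_lt/(_ e e0)/nbhs_ballP[dl /= dl0 Hdl] := cg.
  exists dl => // y yx; rewrite distrC; apply: Hdl.
  by rewrite -ball_normE /ball_/= distrC.
apply/cvgrPdist_lt => e e0; have [dl dl0 Hdl] := H e e0.
apply/nbhs_ballP; exists dl => //= y; rewrite -ball_normE /ball_/= => yx.
by rewrite distrC; apply: Hdl; rewrite distrC.
Qed.

(** Free of quotients, this form needs no exclusion of s = t, and squaring it gives the first-order
    formula behind [dfun_pd]. *)
Lemma is_derive_distP (g : R -> R) (t l : R) :
  is_derive t 1 g l <-> forall e : R, 0 < e ->
    exists2 dl : R, 0 < dl & forall s, `|s - t| < dl ->
      `|g s - g t - l * (s - t)| <= e * `|s - t|.
Proof.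
rewrite is_derive1_caratheodory; split => [[q [qE cq q0]] e e0|H].
  have /continuous_distP/(_ e e0)[dl dl0 Hdl] := cq.
  exists dl => // s st; rewrite qE -q0 -mulrBl normrM.
  by apply: ler_wpM2r => //; apply/ltW/Hdl.
exists (fun s => if s == t then l else (g s - g t) / (s - t)); split.
- move=> z; case: eqP => [->|/eqP zt]; first by rewrite !subrr mulr0.
  by rewrite divfK// subr_eq0.
- apply/continuous_distP => e e0; have [|dl dl0 Hdl] := H (e / 2); first by rewrite divr_gt0.
  exists dl => // s st; rewrite eqxx; case: eqP => [_|/eqP zt]; first by rewrite subrr normr0.
  have nz : s - t != 0 by rewrite subr_eq0.
  have p : 0 < `|s - t| by rewrite normr_gt0.
  rewrite -(ltr_pM2r p) -normrM mulrBl divfK//.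
  apply: le_lt_trans (Hdl _ st) _; rewrite ltr_pM2r//; lra.
- by rewrite eqxx.
Qed.

Lemma is_derive_continuous (g : R -> R) (t l : R) : is_derive t 1 g l -> {for t, continuous g}.
Proof. by move=> [dg _]; apply/differentiable_continuous/derivable1_diffP. Qed.

Lemma is_derive_derive1 (g : R -> R) (t l : R) : is_derive t 1 g l -> derive1 g t = l.
Proof. by move=> [_ dg]; rewrite derive1E. Qed.

Lemma derivable_is_derive1 (g : R -> R) (t : R) : derivable g t 1 -> is_derive t 1 g (derive1 g t).
Proof. by move=> dg; rewrite derive1E; apply: derivableP. Qed.

Lemma derive_le (g h g' h' : R -> R) (a b : R) : a <= b ->
  (forall t, a < t < b -> is_derive t 1 g (g' t)) ->
  (forall t, a < t < b -> is_derive t 1 h (h' t)) ->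
  continuous g -> continuous h ->
  (forall t, a < t < b -> g' t <= h' t) -> g b - g a <= h b - h a.
Proof.
rewrite le_eqVlt => /predU1P[->|ab] dg dh cg ch gh; first by rewrite !subrr.
have [t||c cab E] := @MVT R (h \- g) (h' \- g') a b ab.
- by rewrite in_itv/= => tab; apply: is_deriveB; [exact: dh|exact: dg].
- by apply: continuous_subspaceT => x; apply: continuousB; [exact: ch|exact: cg].
have : 0 <= (h' \- g') c * (b - a).
  by rewrite mulr_ge0 ?subr_ge0 ?(ltW ab)//= gh//; move: cab; rewrite in_itv.
by rewrite -E /=; lra.
Qed.

Lemma derive_nonincr (g g' : R -> R) (a b : R) : a <= b ->
  (forall t, a < t < b -> is_derive t 1 g (g' t)) -> continuous g ->
  (forall t, a < t < b -> g' t <= 0) -> g b <= g a.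
Proof.
move=> ab dg cg g0.
have := @derive_le g (cst 0) g' (cst 0) a b ab dg _ cg _ g0.
rewrite subrr subr_le0; by apply => x; exact: cst_continuous.
Qed.

(** An integral from a base point a is a primitive only to the right of a. The base point therefore
    moves with t, and subtracting the value at 0 makes the choices agree, since two such integrals
    differ by a constant. *)
Lemma ex_primitive (h : R -> R) : continuous h ->
  exists H : R -> R, H 0 = 0 /\ forall t : R, is_derive t 1 H (h t).
Proof.
move=> ch.
pose mu := @lebesgue_measure R.
pose F a (t : R) : R := (\int[mu]_(s in `[a, t]) h s)%R.
have ih a b : mu.-integrable `[a, b] (EFin \o h).
  apply: continuous_compact_integrable; first exact: segment_compact.
  exact: continuous_subspaceT.
have dF (a t : R) : a < t -> is_derive t 1 (F a) (h t).
  move=> at_; have [] := @continuous_FTC1_closed R h a t (t + 1) _ (ih _ _) at_ (ch t).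
    by rewrite ltrDl.
  by move=> d1 d2; rewrite -d2 ; exact: derivable_is_derive1.
have Fab a b t : a < 0 -> b < 0 -> a < t -> b < t -> F a t - F a 0 = F b t - F b 0.
  move=> a0 b0 at_ bt.
  have key (u v : R) : a < u -> b < u -> u <= v -> F a v - F a u = F b v - F b u.
    move=> au bu; rewrite le_eqVlt => /predU1P[->|uv]; first by rewrite !subrr.
    have d (x : R) : u <= x -> is_derive x 1 (F a \- F b) (h x - h x).
      by move=> ux; apply: is_deriveB; apply: dF; apply: lt_le_trans ux.
    have [x||c _] := @MVT_segment R (F a \- F b) (fun x => h x - h x) u v (ltW uv).
    - by rewrite in_itv/= => /andP[/ltW ux _]; exact: d.
    - apply: derivable_within_continuous => x; rewrite in_itv/= => /andP[ux _].
      by have [] := d _ ux.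
    - rewrite subrr mul0r /=; lra.
  have [t0|/ltW t0] := leP 0 t; first exact: key.
  have := key t 0 at_ bt t0; lra.
pose H t := F (- (`|t| + 1)) t - F (- (`|t| + 1)) 0.
have p (t : R) : 0 <= `|t| by [].
exists H; split; first by rewrite /H subrr.
move=> t.
(* Near t one fixed base point must serve: -(|t| + 2) lies to the left of every s with |s - t| <
   1. *)
have : is_derive t 1 (fun s => F (- (`|t| + 2)) s - F (- (`|t| + 2)) 0) (h t).
  rewrite -[h t]subr0; apply: is_deriveB; apply: dF.
  by have := ler_norm (- t); rewrite normrN; have := p t; lra.
apply: near_eq_is_derive; apply/nbhs_ballP; exists 1 => //= s.
rewrite -ball_normE /ball_/= => st; rewrite /H; apply: Fab.
- by have := p t; lra.
- by have := p s; lra.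
- have := ler_norm (t - s); have := ler_norm (- t); rewrite normrN; lra.
- by have := ler_norm (- s); rewrite normrN; have := p s; lra.
Qed.

Definition primitive (h : R -> R) : R -> R :=
  xget (cst 0) [set H | H 0 = 0 /\ forall t : R, is_derive t 1 H (h t)].

Lemma primitiveP h : continuous h ->
  primitive h 0 = 0 /\ forall t : R, is_derive t 1 (primitive h) (h t).
Proof.
move=> /ex_primitive[H HH].
rewrite /primitive; case: xgetP => [_ _ //|/(_ H)]; by move=> /(_ HH).
Qed.

Lemma primitive0 h : continuous h -> primitive h 0 = 0.
Proof. by move=> /primitiveP[]. Qed.

Lemma is_derive_primitive h (t : R) : continuous h -> is_derive t 1 (primitive h) (h t).
Proof. by move=> /primitiveP[]. Qed.

Lemma primitive_continuous h : continuous h -> continuous (primitive h).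
Proof. by move=> ch t; apply: is_derive_continuous; exact: is_derive_primitive. Qed.

Lemma primitive_nondecr (h : R -> R) s t : continuous h -> (forall t, 0 <= h t) ->
  s <= t -> primitive h s <= primitive h t.
Proof.
move=> ch h0 st.
rewrite -lerN2; apply: (@derive_nonincr (fun x => - primitive h x) (fun x => - h x)) => //.
- by move=> u _; apply: is_deriveN; exact: is_derive_primitive.
- by move=> x; apply: continuousN; exact: primitive_continuous.
- by move=> u _; rewrite oppr_le0.
Qed.

Lemma nondecr_bounded_cvgy (F : R -> R) (M : R) :
  (forall s t, 0 <= s -> s <= t -> F s <= F t) -> (forall t, 0 <= t -> F t <= M) ->
  exists l : R, F t @[t --> +oo] --> l.
Proof.
move=> nd bd.
(* Monotonicity is known on the half-line only; composing with the maximum with 0 extends it to the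
   whole line and keeps the germ at infinity. *)
have : cvg ((fun t => F (Num.max 0 t)) x @[x --> +oo]).
  apply/cvg_ex; eexists; apply: nondecreasing_cvgr.
  - move=> s t st; apply: nd; first by rewrite le_max lexx.
    by rewrite ge_max !le_max lexx st orbT.
  - by exists M => _ [t _ <-]; apply: bd; rewrite le_max lexx.
move=> /cvg_ex[l Hl]; exists l; apply: cvg_trans Hl; apply: near_eq_cvg.
exists 0; split => // t t0; by rewrite (max_idPr (ltW t0)).
Qed.

Lemma integral_lty (h : R -> R) (M : R) : continuous h -> (forall t, 0 <= h t) ->
  (forall t, 0 <= t -> primitive h t <= M) ->
  (\int[@lebesgue_measure R]_(t in @Rplus R) (h t)%:E < +oo)%E.
Proof.
move=> ch h0 bd.
have [s t s0 st|l Hl] := @nondecr_bounded_cvgy (primitive h) M _ bd.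
  exact: primitive_nondecr.
have -> : @Rplus R = `[0, +oo[%classic :> set R.
  by apply/seteqP; split => t; rewrite /Rplus/= in_itv/= andbT.
rewrite (@ge0_continuous_FTC2y R h (primitive h) 0 l) => //.
- by rewrite -EFinB ltry.
- exact: continuous_subspaceT.
- by move=> x _; have [] := is_derive_primitive x ch.
- by apply: cvg_at_right_filter; exact: primitive_continuous.
- by move=> x _; apply: is_derive_derive1; exact: is_derive_primitive.
Qed.

End Calculus.

(** * Partial derivatives *)

Section VectorCalculus.
Variable R : realType.
Implicit Types d n : nat.

Lemma coord_le_norm n (v : 'rV[R]_n) i : `|v 0 i| <= `|v|.
Proof.
rewrite [leRHS]/Num.norm/= mx_normrE.
by rewrite (bigD1 (ord0, i))//= le_max ord1 lexx.
Qed.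

Lemma norm_le_coord n (v : 'rV[R]_n) (b : R) : 0 <= b ->
  (forall i, `|v 0 i| <= b) -> `|v| <= b.
Proof.
move=> b0 H; rewrite [leLHS]/Num.norm/= mx_normrE.
apply: (big_ind (fun x => x <= b)) => // [x y xb yb|[i j] _ /=].
  by rewrite ge_max xb yb.
by rewrite ord1; exact: H.
Qed.

Lemma cvg_row (T : Type) (F : set_system T) (FF : Filter F) n
    (g : T -> 'rV[R]_n) (l : 'rV[R]_n) :
  (forall i, g t 0 i @[t --> F] --> l 0 i) -> g t @[t --> F] --> l.
Proof.
move=> H; apply/cvgrPdist_le => e e0.
have : forall i, \forall t \near F, `|l 0 i - g t 0 i| <= e.
  by move=> i; have /cvgrPdist_le := H i; apply.
move=> /filter_forall; apply: filterS => t Ht.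
by apply: norm_le_coord => [|i]; rewrite ?(ltW e0)// !mxE; exact: Ht.
Qed.

Lemma cvg_coord (T : Type) (F : set_system T) (FF : Filter F) n
    (g : T -> 'rV[R]_n) (l : 'rV[R]_n) i :
  g t @[t --> F] --> l -> g t 0 i @[t --> F] --> l 0 i.
Proof.
move=> /cvgrPdist_le H; apply/cvgrPdist_le => e e0.
apply: filterS (H e e0) => t; apply: le_trans.
by have := coord_le_norm (l - g t) i; rewrite !mxE.
Qed.

Lemma continuous_row (V : topologicalType) n (g : V -> 'rV[R]_n) :
  (forall i, continuous (fun t => g t 0 i)) -> continuous g.
Proof. by move=> H x; apply: cvg_row => i; exact: H. Qed.

Lemma continuous_coord (V : topologicalType) n (g : V -> 'rV[R]_n) i :
  continuous g -> continuous (fun t => g t 0 i).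
Proof. by move=> H x; apply: cvg_coord; exact: H. Qed.

Lemma continuous_sum (V : topologicalType) (I : finType) (g : I -> V -> R) :
  (forall i, continuous (g i)) -> continuous (fun v => \sum_i g i v).
Proof.
move=> cg x; apply: cvg_big => [|i _]; last exact: cg.
exact: add_continuous.
Qed.

Lemma continuous_sqr (V : topologicalType) (g : V -> R) :
  continuous g -> continuous (fun v => g v ^+ 2).
Proof. by move=> cg x; apply: cvgM; exact: cg. Qed.

Lemma enorm_sqr n (v : 'rV[R]_n) : enorm v ^+ 2 = \sum_i v 0 i ^+ 2.
Proof. by rewrite /enorm sqr_sqrtr// sumr_ge0// => i _; exact: sqr_ge0. Qed.

Lemma enorm_ge0 n (v : 'rV[R]_n) : 0 <= enorm v.
Proof. exact: sqrtr_ge0. Qed.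

Lemma coord_le_enorm n (v : 'rV[R]_n) i : `|v 0 i| <= enorm v.
Proof.
rewrite -sqrtr_sqr /enorm ler_wsqrtr// (bigD1 i)//= lerDl sumr_ge0// => j _.
exact: sqr_ge0.
Qed.

Lemma norm_le_enorm n (v : 'rV[R]_n) : `|v| <= enorm v.
Proof. by apply: norm_le_coord (enorm_ge0 _) _ => i; exact: coord_le_enorm. Qed.

Lemma enorm0_eq0 n (v : 'rV[R]_n) : enorm v = 0 -> v = 0.
Proof.
move=> v0; apply/rowP => i; rewrite mxE; apply/eqP.
by rewrite -normr_le0 -v0; exact: coord_le_enorm.
Qed.

Lemma enorm_continuous (V : topologicalType) n (g : V -> 'rV[R]_n) :
  continuous g -> continuous (fun t => enorm (g t)).
Proof.
move=> cg x; apply: (@continuous_comp _ _ _ (fun t => \sum_i g t 0 i ^+ 2) Num.sqrt).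
  by apply: continuous_sum => i; apply/continuous_sqr/continuous_coord.
exact: sqrt_continuous.
Qed.

Definition C1 d (g : 'rV[R]_d -> R) :=
  (forall i u, has_pd g i u) /\ (forall i, continuous (pd g i)).

Lemma is_derive_line d (g : 'rV[R]_d -> R) (i : 'I_d) (w : 'rV[R]_d) (h : R) :
  (forall u, has_pd g i u) ->
  is_derive h 1 (fun k : R => g (w + k *: evec R i)) (pd g i (w + h *: evec R i)).
Proof.
move=> /(_ (w + h *: evec R i))/derivable_is_derive1/is_derive_distP H.
apply/is_derive_distP => e e0; have [dl dl0 Hdl] := H e e0; exists dl => // s sh.
have := Hdl (s - h); rewrite !subr0 => /(_ sh).
have -> : w + h *: evec R i + (s - h) *: evec R i = w + s *: evec R i.
  by rewrite -addrA -scalerDl (addrC h) subrK.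
by rewrite scale0r addr0.
Qed.

(** Corners of an axis-parallel staircase from u to u'. Each step moves one coordinate, so partial
    derivatives suffice for a mean value formula. *)
Definition hybrid d (u u' : 'rV[R]_d) (k : nat) : 'rV[R]_d :=
  \row_j (if (j < k)%N then u' 0 j else u 0 j).

Lemma hybridS d (u u' : 'rV[R]_d) (i : 'I_d) :
  hybrid u u' i.+1 = hybrid u u' i + (u' 0 i - u 0 i) *: evec R i.
Proof.
apply/rowP => j; rewrite !mxE eqxx /= ltnS leq_eqVlt; case: eqP => [ji|ji] /=.
  by rewrite (ord_inj ji) ltnn eqxx mulr1 addrC subrK.
by case: (j =P i) => [ji'|_]; [rewrite ji' in ji|rewrite mulr0 addr0].
Qed.

Lemma MVT_origin (p p' : R -> R) (b : R) : (forall h : R, is_derive h 1 p (p' h)) ->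
  exists2 k : R, 0 <= k <= 1 & p b - p 0 = p' (k * b) * b.
Proof.
move=> dp.
have cp : continuous p by move=> x; apply: is_derive_continuous; exact: dp.
have cpw (A : set R) : {within A, continuous p} by exact: continuous_subspaceT.
have [b0|b0|<-] := ltgtP 0 b; last by exists 0; rewrite ?lexx ?ler01// mulr0 subrr.
  have [c /[!in_itv]/= /andP[c0 cb] E] := MVT_segment (ltW b0) (fun x _ => dp x) (cpw _).
  exists (c / b); last by rewrite divfK ?gt_eqF// E subr0.
  by rewrite divr_ge0 ?(ltW b0)//= ler_pdivrMr// mul1r.
have [c /[!in_itv]/= /andP[c0 cb] E] := MVT_segment (ltW b0) (fun x _ => dp x) (cpw _).
exists (c / b); last by rewrite divfK ?lt_eqF// -opprB E; ring.
by rewrite ler_ndivlMr// ler_ndivrMr// mul0r mul1r cb.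
Qed.

(** Telescoping along the corners of [hybrid]. The first bound on [xi] localises near u, for
    first-order expansions; the second keeps it in every centred ball containing u and u', for
    Lipschitz estimates. *)
Lemma mean_value_coord d (g : 'rV[R]_d -> R) (u u' : 'rV[R]_d) : (forall i u, has_pd g i u) ->
  exists xi : 'I_d -> 'rV[R]_d,
    (forall i, `|xi i - u| <= `|u' - u| /\ `|xi i| <= Num.max `|u| `|u'|) /\
    g u' - g u = \sum_i pd g i (xi i) * (u' 0 i - u 0 i).
Proof.
move=> dg.
have /choice[xi Hxi] : forall i : 'I_d, exists xi : 'rV[R]_d,
    (`|xi - u| <= `|u' - u| /\ `|xi| <= Num.max `|u| `|u'|) /\
    g (hybrid u u' i.+1) - g (hybrid u u' i) = pd g i xi * (u' 0 i - u 0 i).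
  move=> i; have [|k k01] := @MVT_origin (fun k : R => g (hybrid u u' i + k *: evec R i))
      (fun h => pd g i (hybrid u u' i + h *: evec R i)) (u' 0 i - u 0 i).
    by move=> h; apply: is_derive_line.
  rewrite -hybridS scale0r addr0 => E.
  exists (hybrid u u' i + (k * (u' 0 i - u 0 i)) *: evec R i); split => //; split.
    apply: norm_le_coord => // j; rewrite !mxE eqxx/=.
    have uj : `|u' 0 j - u 0 j| <= `|u' - u|.
      by have := coord_le_norm (u' - u) j; rewrite !mxE.
    case: (ltnP j i) => ji.
      case: eqP => [ij|_]; first by rewrite ij ltnn in ji.
      by rewrite mulr0 addr0.
    case: eqP => [ij|_]; last by rewrite mulr0 addr0 subrr normr0.
    rewrite mulr1 addrC addKr ij in uj *; apply: le_trans uj.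
    have [k0 k1] := andP k01; rewrite normrM (ger0_norm k0).
    by rewrite ler_piMl.
  have m0 : 0 <= Num.max `|u| `|u'| by rewrite le_max normr_ge0.
  have uj j : `|u 0 j| <= Num.max `|u| `|u'| by rewrite le_max coord_le_norm.
  have uj' j : `|u' 0 j| <= Num.max `|u| `|u'| by rewrite le_max coord_le_norm orbT.
  apply: norm_le_coord => // j; rewrite !mxE eqxx/=.
  case: (ltnP j i) => ji.
    case: eqP => [ij|_]; first by rewrite ij ltnn in ji.
    by rewrite mulr0 addr0.
  case: eqP => [ij|_]; last by rewrite mulr0 addr0.
  rewrite mulr1; have := uj j; have := uj' j; rewrite ij !ler_norml.
  by have [k0 k1] := andP k01; move=> /andP[? ?] /andP[? ?]; apply/andP; split; nra.
exists xi; split => [i|]; first by have [] := Hxi i.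
transitivity (g (hybrid u u' d) - g (hybrid u u' 0)).
  by congr (g _ - g _); apply/rowP => j; rewrite mxE ?ltn_ord.
rewrite -(telescope_sumr (fun k => g (hybrid u u' k)))// big_mkord.
by apply: eq_bigr => i _; have [_ ->] := Hxi i.
Qed.
End VectorCalculus.

(** * First-order expansions, the chain rule and estimates on balls *)

Section VectorCalculus2.
Variable R : realType.
Implicit Types d n : nat.

Lemma exists2_choice (I T : Type) (P Q : I -> T -> Prop) :
  (forall i, exists2 a, P i a & Q i a) ->
  exists2 a : I -> T, forall i, P i (a i) & forall i, Q i (a i).
Proof.
move=> H; have /choice[a Ha] : forall i, exists a, P i a /\ Q i a.
  by move=> i; have [a ? ?] := H i; exists a.
by exists a => i; have [] := Ha i.
Qed.

Lemma common_radius (I : finType) (P : I -> R -> Prop) :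
  (forall i a b, b <= a -> P i a -> P i b) ->
  (forall i, exists2 a : R, 0 < a & P i a) -> exists2 a : R, 0 < a & forall i, P i a.
Proof.
move=> mono /exists2_choice[a a0 Pa].
exists (\big[Num.min/1]_i a i); first by apply: lt_bigmin.
by move=> i; apply: mono (Pa i); exact: bigmin_le_cond.
Qed.

(** The error is measured by the l1 distance because that is how [desingularize] measures the
    variation of a curve. *)
Lemma first_order d (g : 'rV[R]_d -> R) (u : 'rV[R]_d) (e : R) : C1 g -> 0 < e ->
  exists2 r : R, 0 < r & forall u', `|u' - u| < r ->
    `|g u' - g u - \sum_i pd g i u * (u' 0 i - u 0 i)| <= e * \sum_i `|u' 0 i - u 0 i|.
Proof.
move=> [dg cg] e0.
have [//|i|r r0 Hr] := @common_radius 'I_d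
  (fun i r => forall y, `|y - u| < r -> `|pd g i y - pd g i u| < e).
- by move=> i a b ba H y yb; apply: H; apply: lt_le_trans ba.
- by have /continuous_distP/(_ e e0) := cg i u.
exists r => // u' u'r; have [xi [Hxi ->]] := @mean_value_coord R d g u u' dg.
rewrite -sumrB mulr_sumr; apply: le_trans (ler_norm_sum _ _ _) _.
apply: ler_sum => i _; rewrite -mulrBl normrM ler_wpM2r//; apply/ltW/Hr.
by have [xiu _] := Hxi i; apply: le_lt_trans u'r.
Qed.

Lemma is_derive_chain d (g : 'rV[R]_d -> R) (u : R -> 'rV[R]_d) (u' : 'rV[R]_d) (t : R) :
  C1 g -> (forall i, is_derive t 1 (fun s => u s 0 i) (u' 0 i)) ->
  is_derive t 1 (fun s => g (u s)) (\sum_i pd g i (u t) * u' 0 i).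
Proof.
move=> Cg du; apply/is_derive_distP => e e0.
(* [D] bounds the l1 speed of u and [G] the l1 norm of the gradient; the errors made on g and on u
   get half of e each. The cap 1 in [e2] makes |u'_i| + 1 a Lipschitz constant of u_i at t. *)
pose D : R := \sum_i (`|u' 0 i| + 1); pose G : R := \sum_i `|pd g i (u t)|.
have D0 : 0 <= D by apply: sumr_ge0 => i _; rewrite addr_ge0.
have G0 : 0 <= G by apply: sumr_ge0.
have [|r r0 Hr] := @first_order d g (u t) (e / (2 * (D + 1))) Cg.
  by rewrite divr_gt0// mulr_gt0// ltr_wpDl.
pose e2 : R := Num.min 1 (e / (2 * (G + 1))).
have e20 : 0 < e2 by rewrite lt_min ltr01 divr_gt0// mulr_gt0// ltr_wpDl.
have [//|i|r2 r20 Hr2] := @common_radius 'I_d (fun i r => forall s, `|s - t| < r ->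
   `|u s 0 i - u t 0 i - u' 0 i * (s - t)| <= e2 * `|s - t|).
- by move=> i a b ba H y yb; apply: H; apply: lt_le_trans ba.
- by have /is_derive_distP/(_ e2 e20) := du i.
have lip s : `|s - t| < r2 -> forall i, `|u s 0 i - u t 0 i| <= (`|u' 0 i| + 1) * `|s - t|.
  move=> st i; rewrite -[u s 0 i - _](subrK (u' 0 i * (s - t))).
  apply: le_trans (ler_normD _ _) _; rewrite normrM mulrDl mul1r [leRHS]addrC lerD2r.
  apply: le_trans (Hr2 i _ st) _; rewrite ler_piMl//.
  by rewrite /e2 ge_min lexx.
exists (Num.min r2 (r / (D + 1))).
  by rewrite lt_min r20 divr_gt0// ltr_wpDl.
move=> s; rewrite lt_min => /andP[st str].
have ur : `|u s - u t| < r.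
  apply: (@le_lt_trans _ _ ((D + 1) * `|s - t|)); last first.
    by rewrite mulrC -ltr_pdivlMr// ltr_wpDl.
  apply: norm_le_coord => [|i]; first by rewrite mulr_ge0// addr_ge0.
  rewrite !mxE; apply: le_trans (lip _ st i) _; apply: ler_wpM2r => //.
  apply: ler_wpDr => //; rewrite /D (bigD1 i)//= lerDl; apply: sumr_ge0 => j _.
  exact: addr_ge0.
have -> : g (u s) - g (u t) - (\sum_i pd g i (u t) * u' 0 i) * (s - t) =
    (g (u s) - g (u t) - \sum_i pd g i (u t) * (u s 0 i - u t 0 i)) +
    \sum_i pd g i (u t) * (u s 0 i - u t 0 i - u' 0 i * (s - t)).
  rewrite mulr_suml [X in _ = _ + X](eq_bigr (fun i =>
     pd g i (u t) * (u s 0 i - u t 0 i) - pd g i (u t) * u' 0 i * (s - t))).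
    by rewrite sumrB; ring.
  by move=> i _; ring.
have half : e = e / 2 + e / 2 by lra.
apply: le_trans (ler_normD _ _) _; rewrite [in leRHS]half mulrDl; apply: lerD.
  apply: le_trans (Hr _ ur) _.
  have : \sum_i `|u s 0 i - u t 0 i| <= D * `|s - t|.
    by rewrite /D mulr_suml; apply: ler_sum => i _; exact: lip.
  move=> H; apply: le_trans (_ : e / (2 * (D + 1)) * ((D + 1) * `|s - t|) <= _).
    apply: ler_wpM2l; first by rewrite divr_ge0 ?(ltW e0)// mulr_ge0// addr_ge0.
    by apply: le_trans H _; rewrite ler_wpM2r// lerDl.
  have D1 : D + 1 != 0 by rewrite gt_eqF// ltr_wpDl.
  by rewrite le_eqVlt; apply/orP; left; apply/eqP; field.
apply: le_trans (ler_norm_sum _ _ _) _.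
apply: (@le_trans _ _ (G * (e2 * `|s - t|))).
  by rewrite /G mulr_suml; apply: ler_sum => i _; rewrite normrM ler_wpM2l// Hr2.
rewrite mulrA ler_wpM2r//.
apply: (@le_trans _ _ ((G + 1) * (e / (2 * (G + 1))))).
  apply: ler_pM => //; first exact: ltW.
    by rewrite lerDl.
  by rewrite /e2 ge_min lexx orbT.
have G1 : G + 1 != 0 by rewrite gt_eqF// ltr_wpDl.
by rewrite le_eqVlt; apply/orP; left; apply/eqP; field.
Qed.

Lemma closed_ball_compact d (B : R) : compact [set u : 'rV[R]_d | `|u| <= B].
Proof.
apply: bounded_closed_compact.
  exists B; split; first exact: num_real.
  by move=> x Bx u /= uB; apply: le_trans uB (ltW Bx).
have -> : [set u : 'rV[R]_d | `|u| <= B] = Num.norm @^-1` [set x | x <= B] by [].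
by apply: closed_comp => [x _|]; [exact: norm_continuous|exact: closed_le].
Qed.

Lemma bounded_on_ball d (g : 'rV[R]_d -> R) (B : R) : continuous g ->
  exists2 M : R, 0 <= M & forall u, `|u| <= B -> `|g u| <= M.
Proof.
move=> cg; have [B0|B0] := leP 0 B; last first.
  exists 0 => // u uB; exfalso.
  by have := le_lt_trans uB B0; rewrite normr_lt0.
have [|||c _ H] := @compact_EVT_max _ R (fun u => `|g u|) [set u : 'rV[R]_d | `|u| <= B].
- by exists 0; rewrite /= normr0.
- exact: closed_ball_compact.
- apply: continuous_subspaceT => x.
  by apply: (@continuous_comp _ _ _ g Num.norm); [exact: cg|exact: norm_continuous].
- by exists `|g c| => // u uB; apply: H; rewrite inE.
Qed.

Lemma lipschitz_on_ball d (g : 'rV[R]_d -> R) (B : R) : C1 g ->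
  exists2 L : R, 0 <= L & forall u u', `|u| <= B -> `|u'| <= B ->
    `|g u' - g u| <= L * `|u' - u|.
Proof.
move=> [dg cg].
have /exists2_choice[M M0 HM] : forall i,
    exists2 M : R, 0 <= M & forall u, `|u| <= B -> `|pd g i u| <= M.
  by move=> i; apply: bounded_on_ball; exact: cg.
exists (\sum_i M i); first exact: sumr_ge0.
move=> u u' uB uB'; have [xi [Hxi ->]] := @mean_value_coord R d g u u' dg.
apply: le_trans (ler_norm_sum _ _ _) _; rewrite mulr_suml; apply: ler_sum => i _.
rewrite normrM; apply: ler_pM => //.
  have [_ xiB] := Hxi i; apply: HM; apply: le_trans xiB _.
  by rewrite ge_max uB uB'.
by have := coord_le_norm (u' - u) i; rewrite !mxE.
Qed.

Lemma grad_lipschitz d (f : 'rV[R]_d -> R) (B : R) : (forall i, C1 (pd f i)) ->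
  exists2 L : R, 0 <= L & forall u u', `|u| <= B -> `|u'| <= B ->
    `|grad f u' - grad f u| <= L * `|u' - u|.
Proof.
move=> Cf.
have /exists2_choice[L L0 HL] : forall i, exists2 L : R, 0 <= L &
    forall u u', `|u| <= B -> `|u'| <= B -> `|pd f i u' - pd f i u| <= L * `|u' - u|.
  by move=> i; exact: lipschitz_on_ball.
have S0 : 0 <= \sum_i L i by exact: sumr_ge0.
exists (\sum_i L i) => // u u' uB u'B; apply: norm_le_coord => [|i].
  by rewrite mulr_ge0.
rewrite !mxE; apply: le_trans (HL i _ _ uB u'B) _; rewrite ler_wpM2r//.
by rewrite (bigD1 i)//= lerDl sumr_ge0.
Qed.

Lemma C2_C1 d (f : 'rV[R]_d -> R) : C2 f -> C1 f.
Proof. by case=> _ ? ? _ _; split. Qed.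

Lemma C2_C1_pd d (f : 'rV[R]_d -> R) i : C2 f -> C1 (pd f i).
Proof. by case=> _ _ _ ? ?; split. Qed.

Lemma grad_continuous d (f : 'rV[R]_d -> R) : C1 f -> continuous (grad f).
Proof.
move=> [_ cf]; apply: continuous_row => i.
by rewrite (_ : (fun t => _) = pd f i)//; apply/funext => u; rewrite mxE.
Qed.

Lemma C1_continuous d (f : 'rV[R]_d -> R) : C1 f -> continuous f.
Proof.
move=> Cf u; apply/continuous_distP => e e0.
have [L L0 HL] := lipschitz_on_ball (`|u| + 1) Cf.
have L1 : 0 < L + 1 by rewrite ltr_wpDl.
exists (Num.min 1 (e / (L + 1))); first by rewrite lt_min ltr01 divr_gt0.
move=> y; rewrite lt_min => /andP[y1 ye].
apply: le_lt_trans (HL u y _ _) _.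
- by rewrite lerDl.
- by rewrite -(subrK u y) (addrC `|u|) (le_trans (ler_normD _ _))// lerD2r ltW.
- move: ye; rewrite ltr_pdivlMr// => ye; apply: le_lt_trans ye.
  by rewrite mulrC ler_wpM2l// lerDl.
Qed.

End VectorCalculus2.

(** * Definable sets and functions *)

Section Definability.
Variable R : realType.
Variable S : forall n : nat, set (set 'rV[R]_n).
Hypothesis HS : o_minimal_structure S.
Implicit Types n m k : nat.

Lemma S_alg n (A : set 'rV[R]_n) : algebraic_set A -> S A.
Proof. by have [H _ _ _ _] := HS; exact: H. Qed.

Lemma S_or n (P Q : 'rV[R]_n -> Prop) :
  S [set v | P v] -> S [set v | Q v] -> S [set v | P v \/ Q v].
Proof. by have [_ [_ [H _]] _ _ _] := HS; exact: H. Qed.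

Lemma S_not n (P : 'rV[R]_n -> Prop) : S [set v | P v] -> S [set v | ~ P v].
Proof. by have [_ [_ [_ H]] _ _ _] := HS; exact: H. Qed.

Lemma S_eq n (P Q : 'rV[R]_n -> Prop) : (forall v, P v <-> Q v) ->
  S [set v | P v] -> S [set v | Q v].
Proof.
by move=> PQ; rewrite (_ : [set v | P v] = [set v | Q v])//; apply/seteqP; split => v /PQ.
Qed.

Lemma S_and n (P Q : 'rV[R]_n -> Prop) :
  S [set v | P v] -> S [set v | Q v] -> S [set v | P v /\ Q v].
Proof.
move=> SP SQ; apply: (@S_eq _ (fun v => ~ (~ P v \/ ~ Q v))); last first.
  by apply/S_not/S_or; exact: S_not.
move=> v; split => [|[p q] [|]//].
by move=> /not_orP[/contrapT p /contrapT q].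
Qed.

Lemma S_imp n (P Q : 'rV[R]_n -> Prop) :
  S [set v | P v] -> S [set v | Q v] -> S [set v | P v -> Q v].
Proof.
move=> SP SQ; apply: (@S_eq _ (fun v => ~ P v \/ Q v)); last first.
  by apply: S_or => //; exact: S_not.
by move=> v; rewrite implyE.
Qed.

Lemma S_true n : S [set v : 'rV[R]_n | True].
Proof. by apply: S_alg; exists [::]; apply/seteqP; split. Qed.

Lemma S_forall_ord n k (P : 'I_k -> 'rV[R]_n -> Prop) :
  (forall i, S [set v | P i v]) -> S [set v | forall i, P i v].
Proof.
move=> SP.
apply: (@S_eq _ (fun v => forall i, i \in enum 'I_k -> P i v)).
  by move=> v; split => H i; [apply: H; rewrite mem_enum|move=> _; exact: H].
elim: (enum 'I_k) => [|j s IH]; first by apply: S_eq (@S_true n) => v; split.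
apply: S_eq (S_and (SP j) IH) => v; split => [[Pj Ps] i|H].
  by rewrite inE => /predU1P[->//|]; exact: Ps.
by split => [|i iS]; apply: H; rewrite inE ?eqxx ?iS ?orbT.
Qed.

Lemma S_prod m n (P : 'rV[R]_m -> Prop) (Q : 'rV[R]_n -> Prop) :
  S [set v | P v] -> S [set v | Q v] ->
  S [set v : 'rV[R]_(m + n) | P (lsubmx v) /\ Q (rsubmx v)].
Proof.
move=> SP SQ; have [_ _ H _ _] := HS.
apply: S_eq (H _ _ _ _ SP SQ) => v; split => [[a Pa [b Qb ->]]|[Pa Qb]].
  by rewrite row_mxKl row_mxKr.
by exists (lsubmx v) => //; exists (rsubmx v) => //; rewrite hsubmxK.
Qed.

Lemma S_cast n m (e : n = m) (A : set 'rV[R]_n) :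
  S A -> S [set v : 'rV[R]_m | A (castmx (erefl, esym e) v)].
Proof. by case: m / e => SA; apply: S_eq SA => v; rewrite castmx_id. Qed.

(** The projection axiom removes a single coordinate; induction on k removes a block, with casts for
    n + 0 = n and n + k.+1 = n + k + 1. *)
Lemma S_ex n k (P : 'rV[R]_n -> 'rV[R]_k -> Prop) :
  S [set v : 'rV[R]_(n + k) | P (lsubmx v) (rsubmx v)] ->
  S [set u | exists w, P u w].
Proof.
have proj (A : set 'rV[R]_(n + k)) : S A -> S [set lsubmx v | v in A].
  elim: k A {P} => [|k IH] A SA.
    have e := addn0 n.
    have := S_cast e SA; apply: S_eq => v; split => [Av|[w Aw <-]].
      exists (castmx (erefl, esym e) v) => //; apply/rowP => j.
      by rewrite mxE castmxE /= ord1; congr (v _ _); apply: val_inj.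
    rewrite (_ : castmx _ _ = w)//; apply/rowP => j.
    rewrite castmxE mxE ord1; congr (w _ _); exact: val_inj.
  have e : (n + k.+1 = n + k + 1)%N by rewrite addn1 addnS.
  have [_ _ _ H _] := HS.
  have /H /IH := S_cast e SA; apply: S_eq => v; split.
    move=> [w [x Ax <-] <-]; exists (castmx (erefl, esym e) x) => //.
    by apply/rowP => j; rewrite !mxE castmxE /= ord1; congr (x _ _); apply: val_inj.
  move=> [w Aw <-]; exists (lsubmx (castmx (erefl, e) w)).
    exists (castmx (erefl, e) w) => //=.
    by rewrite castmx_comp castmx_id.
  by apply/rowP => j; rewrite !mxE castmxE /= ord1; congr (w _ _); apply: val_inj.
move=> /proj; apply: S_eq => u; split => [[v Pv <-]|[w Pw]]; first by exists (rsubmx v).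
by exists (row_mx u w) => //=; rewrite row_mxKl ?row_mxKr.
Qed.

(** The set is the projection of the product of R^m with B, cut by the polynomial equations w_j =
    v_(s j). Permuting, duplicating and adding variables are special cases. *)
Lemma S_coord_subst m k (s : 'I_k -> 'I_m) (B : 'rV[R]_k -> Prop) :
  S [set w | B w] -> S [set v : 'rV[R]_m | B (\row_j v 0 (s j))].
Proof.
move=> SB.
pose q j : pterm R (m + k) :=
  PAdd (PVar R (rshift m j)) (PMul (PConst _ (-1)) (PVar R (lshift k (s j)))).
have qE v j : peval (q j) v = v 0 (rshift m j) - v 0 (lshift k (s j)).
  by rewrite /= mulN1r.
have Sq : S [set v : 'rV[R]_(m + k) | forall j, rsubmx v 0 j = lsubmx v 0 (s j)].
  apply: S_alg; exists [seq q j | j <- enum 'I_k]; apply/seteqP; split => v /=; rewrite all_map.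
    move=> H; apply/allP => j _; rewrite /preim /= -[_ + _]/(peval (q j) v) qE.
    by have := H j; rewrite !mxE => ->; rewrite subrr.
  move=> /allP H j; have := H j; rewrite mem_enum => /(_ isT).
  by rewrite /preim /= -[_ + _]/(peval (q j) v) qE !mxE subr_eq0 => /eqP.
have := S_and (S_prod (@S_true m) SB) Sq.
pose P (u : 'rV[R]_m) (w : 'rV[R]_k) := (True /\ B w) /\ forall j, w 0 j = u 0 (s j).
move=> /(@S_ex m k P); apply: S_eq => v; split => [[w [[_ Bw] H]]|Bv].
  by rewrite (_ : \row__ _ = w)//; apply/rowP => j; rewrite mxE H.
by exists (\row_j v 0 (s j)); split => // j; rewrite mxE.
Qed.

Definition dfun n (g : 'rV[R]_n -> R) :=
  S [set v : 'rV[R]_(n + 1) | v 0 (rshift n 0) = g (lsubmx v)].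

Lemma eq_dfun n (g h : 'rV[R]_n -> R) : g =1 h -> dfun g -> dfun h.
Proof. by move=> /funext ->. Qed.

Lemma dfun_coord_subst m n (s : 'I_n -> 'I_m) (g : 'rV[R]_n -> R) :
  dfun g -> dfun (fun v : 'rV[R]_m => g (\row_j v 0 (s j))).
Proof.
pose s' (i : 'I_(n + 1)) : 'I_(m + 1) :=
  match fintype.split i with inl j => lshift 1 (s j) | inr j => rshift m j end.
move=> /(S_coord_subst s'); apply: S_eq => v.
rewrite mxE /s' (unsplitK (inr 0)).
rewrite (_ : lsubmx _ = \row_j (lsubmx v) 0 (s j))//.
by apply/rowP => j; rewrite !mxE (unsplitK (inl j)).
Qed.

Lemma dfun_lsub n k (g : 'rV[R]_n -> R) :
  dfun g -> dfun (fun v : 'rV[R]_(n + k) => g (lsubmx v)).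
Proof.
move=> /(dfun_coord_subst (lshift k)); apply: eq_dfun => v; congr g.
by apply/rowP => j; rewrite !mxE.
Qed.

Lemma dfun_rsub n k (g : 'rV[R]_k -> R) :
  dfun g -> dfun (fun v : 'rV[R]_(n + k) => g (rsubmx v)).
Proof.
move=> /(dfun_coord_subst (@rshift n k)); apply: eq_dfun => v; congr g.
by apply/rowP => j; rewrite !mxE.
Qed.

Lemma dfun_peval n (p : pterm R n) : dfun (peval p).
Proof.
pose fix lift (q : pterm R n) : pterm R (n + 1) :=
  match q with
  | PVar i => PVar R (lshift 1 i)
  | PConst c => PConst _ c
  | PAdd a b => PAdd (lift a) (lift b)
  | PMul a b => PMul (lift a) (lift b)
  end.
have liftE q v : peval (lift q) v = peval q (lsubmx v).
  by elim: q => [i|c|a IHa b IHb|a IHa b IHb] /=; rewrite ?mxE// IHa IHb.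
apply: S_alg.
exists [:: PAdd (PVar R (rshift n 0)) (PMul (PConst _ (-1)) (lift p))].
apply/seteqP; split => v /=; rewrite liftE mulN1r subr_eq0 andbT => /eqP//.
Qed.

Lemma dfun_coord n i : dfun (fun v : 'rV[R]_n => v 0 i).
Proof. exact: (dfun_peval (PVar R i)). Qed.

Lemma dfun_cst n (c : R) : dfun (fun v : 'rV[R]_n => c).
Proof. exact: (dfun_peval (PConst n c)). Qed.

(** Projection of the product of R^n with B, cut by the graph of G. *)
Lemma S_preimage n k (G : 'rV[R]_n -> 'rV[R]_k) (B : 'rV[R]_k -> Prop) :
  (forall i, dfun (fun v => G v 0 i)) -> S [set w | B w] -> S [set v | B (G v)].
Proof.
move=> dG SB.
have SG : S [set v : 'rV[R]_(n + k) | forall i, rsubmx v 0 i = G (lsubmx v) 0 i].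
  apply: S_forall_ord => i.
  pose s (j : 'I_(n + 1)) : 'I_(n + k) :=
    match fintype.split j with inl j => lshift k j | inr _ => rshift n i end.
  have := S_coord_subst s (dG i); apply: S_eq => v.
  rewrite mxE /s (unsplitK (inr 0)) mxE.
  rewrite (_ : lsubmx _ = lsubmx v)//.
  by apply/rowP => j; rewrite !mxE (unsplitK (inl j)).
have := S_and (S_prod (@S_true n) SB) SG.
move=> /(@S_ex n k (fun u w => (True /\ B w) /\ forall i, w 0 i = G u 0 i)).
apply: S_eq => v; split => [[w [[_ Bw] H]]|Bv]; last by exists (G v).
by rewrite (_ : G v = w)//; apply/rowP => j; rewrite H.
Qed.

Lemma dfun_comp n k (G : 'rV[R]_n -> 'rV[R]_k) (g : 'rV[R]_k -> R) :
  (forall i, dfun (fun v => G v 0 i)) -> dfun g -> dfun (fun v => g (G v)).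
Proof.
move=> dG dg.
have := @S_preimage (n + 1) (k + 1)
  (fun v => row_mx (G (lsubmx v)) (rsubmx v)) _ _ dg.
move=> H; apply: S_eq (H _) => [v|i].
  by rewrite /= row_mxKl row_mxEr mxE.
rewrite -(splitK i); case: (fintype.split i) => j /=.
  by apply: eq_dfun (dfun_lsub 1 (dG j)) => v; rewrite row_mxEl.
by apply: eq_dfun (dfun_coord (rshift n j)) => v; rewrite row_mxEr mxE.
Qed.

Lemma dfun2 (op : R -> R -> R) n (a b : 'rV[R]_n -> R) :
  dfun (fun v : 'rV[R]_2 => op (v 0 0) (v 0 1)) -> dfun a -> dfun b ->
  dfun (fun v => op (a v) (b v)).
Proof.
move=> dop da db.
have /= := @dfun_comp n 2 (fun v => \row_(i < 2) if i == 0 then a v else b v) _ _ dop.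
move=> H; apply: eq_dfun (H _) => [v|i]; first by rewrite !mxE.
by case: (eqVneq i 0) => [->|/negPf i0];
  [apply: eq_dfun da|apply: eq_dfun db] => v; rewrite mxE ?i0.
Qed.

Lemma dfunD n (a b : 'rV[R]_n -> R) : dfun a -> dfun b -> dfun (fun v => a v + b v).
Proof. apply: (dfun2 (op := +%R)); exact: (dfun_peval (PAdd (PVar R 0) (PVar R 1))). Qed.

Lemma dfunM n (a b : 'rV[R]_n -> R) : dfun a -> dfun b -> dfun (fun v => a v * b v).
Proof. apply: (dfun2 (op := *%R)); exact: (dfun_peval (PMul (PVar R 0) (PVar R 1))). Qed.

Lemma dfunN n (a : 'rV[R]_n -> R) : dfun a -> dfun (fun v => - a v).
Proof.
move=> da; apply: eq_dfun (dfunM (dfun_cst n (-1)) da) => v; exact: mulN1r.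
Qed.

Lemma dfunB n (a b : 'rV[R]_n -> R) : dfun a -> dfun b -> dfun (fun v => a v - b v).
Proof. by move=> da db; apply: dfunD => //; exact: dfunN. Qed.

Lemma dfunX2 n (a : 'rV[R]_n -> R) : dfun a -> dfun (fun v => a v ^+ 2).
Proof. by move=> da; exact: dfunM. Qed.

Lemma dfun_sum n (I : finType) (a : I -> 'rV[R]_n -> R) :
  (forall i, dfun (a i)) -> dfun (fun v => \sum_i a i v).
Proof.
move=> da; rewrite unlock; elim: (index_enum I) => [|i s IH] /=; first exact: dfun_cst.
exact: dfunD.
Qed.

Definition dfun1 (g : R -> R) := dfun (fun v : 'rV[R]_1 => g (v 0 0)).

Lemma dfun1_comp n (g : R -> R) (a : 'rV[R]_n -> R) :
  dfun1 g -> dfun a -> dfun (fun v => g (a v)).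
Proof.
move=> dg da; have /= := @dfun_comp n 1 (fun v => \row_i a v) _ _ dg.
move=> H; apply: eq_dfun (H _) => [v|i]; first by rewrite mxE.
by apply: eq_dfun da => v; rewrite mxE.
Qed.

Lemma S_itv n (I : interval R) (a : 'rV[R]_n -> R) : dfun a -> S [set v | a v \in I].
Proof.
move=> da.
have SI : S [set w : 'rV[R]_1 | w 0 0 \in I].
  have [_ _ _ _ H] := HS; apply/H; exists [:: I].
  by apply/seteqP; split => v /=; rewrite orbF.
have := @S_preimage n 1 (fun v => \row__ a v) _ _ SI.
move=> H; apply: S_eq (H _) => [v|i]; first by rewrite mxE.
by apply: eq_dfun da => v; rewrite mxE.
Qed.

Lemma S_lt n (a b : 'rV[R]_n -> R) : dfun a -> dfun b -> S [set v | (a v < b v : Prop)].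
Proof.
move=> da db; apply: S_eq (S_itv `]0, +oo[ (dfunB db da)) => v.
by rewrite in_itv/= andbT subr_gt0.
Qed.

Lemma S_le n (a b : 'rV[R]_n -> R) : dfun a -> dfun b -> S [set v | (a v <= b v : Prop)].
Proof.
move=> da db; apply: S_eq (S_itv `[0, +oo[ (dfunB db da)) => v.
by rewrite in_itv/= andbT subr_ge0.
Qed.

Lemma S_eqr n (a b : 'rV[R]_n -> R) : dfun a -> dfun b -> S [set v | a v = b v].
Proof.
move=> da db; apply: S_eq (S_and (S_le da db) (S_le db da)) => v.
by split => [[ab ba]|->]; [apply/eqP; rewrite eq_le ab ba|rewrite lexx].
Qed.

Lemma S_ex1 n (P : 'rV[R]_n -> R -> Prop) :
  S [set v : 'rV[R]_(n + 1) | P (lsubmx v) (v 0 (rshift n 0))] ->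
  S [set u | exists a, P u a].
Proof.
move=> SP; have := @S_ex n 1 (fun u w => P u (w 0 0)).
move=> H; apply: S_eq (H _) => [u|].
  by split => [[w Pw]|[a Pa]]; [exists (w 0 0)|exists (const_mx a); rewrite mxE].
by apply: S_eq SP => v; rewrite mxE.
Qed.

Lemma S_forall n k (P : 'rV[R]_n -> 'rV[R]_k -> Prop) :
  S [set v : 'rV[R]_(n + k) | P (lsubmx v) (rsubmx v)] ->
  S [set u | forall w, P u w].
Proof.
move=> /S_not/(@S_ex n k (fun u w => ~ P u w))/S_not.
by apply: S_eq => u; rewrite -forallNE; split => H w; have := H w; rewrite notK.
Qed.

Lemma S_forall1 n (P : 'rV[R]_n -> R -> Prop) :
  S [set v : 'rV[R]_(n + 1) | P (lsubmx v) (v 0 (rshift n 0))] ->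
  S [set u | forall a, P u a].
Proof.
move=> /S_not/(@S_ex1 n (fun u w => ~ P u w))/S_not.
by apply: S_eq => u; rewrite -forallNE; split => H w; have := H w; rewrite notK.
Qed.

Lemma dfun_graph n (g : 'rV[R]_n -> R) (P : 'rV[R]_n -> R -> Prop) :
  (forall v y, P v y <-> y = g v) ->
  S [set v : 'rV[R]_(n + 1) | P (lsubmx v) (v 0 (rshift n 0))] -> dfun g.
Proof. by move=> H; apply: S_eq => v; exact: H. Qed.

End Definability.

(** * Monotone germs of definable functions *)

(** A point x is labelled by an integer N with 1 / N < e x and by the integer part of x N. Two
    points with equal labels are closer than both of their radii, so each would have the smaller
    value. Labels are thus injective and the interval countable, against its positive measure. *)
Lemma strict_local_min_contra (R : realType) (g : R -> R) (b : R) : 0 < b ->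
  ~ (forall x, 0 < x < b -> exists2 e : R, 0 < e &
       forall y, y != x -> `|y - x| < e -> g x < g y).
Proof.
move=> b0 H.
have /exists2_choice[e e0 He] : forall x, exists2 e : R, 0 < e &
    (0 < x < b -> forall y, y != x -> `|y - x| < e -> g x < g y).
  move=> x; have [/H[e e0 He]|nx] := boolP (0 < x < b); first by exists e.
  by exists 1.
pose N x := Num.bound (e x)^-1.
have HN x : 1 < e x * (N x)%:R.
  have := @archi_boundP R (e x)^-1; rewrite invr_ge0 (ltW (e0 x)) => /(_ isT).
  by rewrite -/(N x) => h; rewrite mulrC -ltr_pdivrMr// div1r.
pose phi x : nat := pickle (N x, Num.floor (x * (N x)%:R)).
have : countable `]0, b[%classic.
  apply/countable_injP; exists phi => x y.
  rewrite !inE /= !in_itv/= => xb yb; rewrite /phi => /(pcan_inj pickleK)[NE].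
  have {}NE : N x = N y by rewrite /N /Num.bound NE.
  move=> fE; apply/eqP/negPn/negP => xy.
  have close : `|x - y| * (N x)%:R < 1.
    have := floor_itv (x * (N x)%:R); have := floor_itv (y * (N y)%:R).
    rewrite fE -NE => /andP[p1 p2] /andP[p3 p4].
    have -> : (N x)%:R = `|(N x)%:R| :> R by rewrite ger0_norm.
    rewrite -normrM mulrBl ltr_norml.
    by move: p2 p4; rewrite intrD => p2 p4; apply/andP; split; lra.
  have Np : 0 < (N x)%:R :> R.
    by have := lt_trans ltr01 (HN x); rewrite pmulr_rgt0.
  have ltx : `|x - y| < e x.
    by rewrite -(ltr_pM2r Np); apply: lt_trans close (HN x).
  have lty : `|x - y| < e y.
    by rewrite -(ltr_pM2r Np); apply: lt_trans close _; rewrite NE.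
  have := He x xb y; rewrite eq_sym distrC => /(_ xy ltx).
  by move=> /lt_trans/(_ (He y yb x xy lty)); rewrite ltxx.
move=> /countable_lebesgue_measure0; rewrite lebesgue_measure_itv/= lte_fin b0.
by rewrite sube0 => -[] /eqP; rewrite gt_eqF.
Qed.

(** Real induction without continuity: let s be the supremum of the z up to which g stays above g x.
    The left-hand condition gives g x <= g s, and the right-hand one leads beyond s unless s = y. *)
Lemma local_nondecr (R : realType) (g : R -> R) (b : R) :
  (forall x, 0 < x < b -> exists2 e : R, 0 < e & forall y, x < y < x + e -> g x <= g y) ->
  (forall x, 0 < x < b -> exists2 e : R, 0 < e & forall y, x - e < y < x -> g y <= g x) ->
  forall x y, 0 < x -> x <= y -> y < b -> g x <= g y.
Proof.
move=> Hr Hl x y x0 xy yb.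
pose A : set R := [set z | x <= z <= y /\ forall w, x <= w <= z -> g x <= g w].
have Ax : A x.
  split; first by rewrite lexx.
  by move=> w /andP[xw wx]; have -> : w = x by apply/eqP; rewrite eq_le xw wx.
have hsA : has_sup A.
  by split; [exists x|exists y => z [/andP[]]].
pose s := sup A.
have xs : x <= s by exact: sup_upper_bound.
have sy : s <= y by apply: sup_le_ub => [|z [/andP[]]//]; exists x.
have s0 : 0 < s < b by rewrite (lt_le_trans x0 xs) (le_lt_trans sy yb).
have below w : x <= w -> w < s -> g x <= g w.
  move=> xw ws; have [|z [_ Az] wz] := @sup_adherent R A (s - w) _ hsA; first by rewrite subr_gt0.
  by apply: Az; rewrite xw; apply: ltW; move: (wz); rewrite -/s subKr.
have gs : g x <= g s.
  move: xs; rewrite le_eqVlt => /predU1P[<-//|xs].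
  have [e e0 He] := Hl s s0.
  pose w := Num.max x (s - e / 2).
  have ws : w < s by rewrite gt_max xs ltrBlDr ltrDl divr_gt0.
  have xw : x <= w by rewrite le_max lexx.
  apply: le_trans (below _ xw ws) (He _ _); rewrite ws andbT.
  by rewrite lt_max; apply/orP; right; lra.
have [<-//|ys] := eqVneq s y.
have [e e0 He] := Hr s s0.
have {ys} sy' : s < y by rewrite lt_neqAle ys sy.
pose z := Num.min y (s + e / 2).
have Az : A z.
  split.
    by rewrite le_min ge_min lexx /= andbT xy /=; lra.
  move=> w /andP[xw wz]; have [ws|sw|->//] := ltgtP w s; first exact: below.
  apply: le_trans gs (He _ _); rewrite sw /=.
  by apply: le_lt_trans wz _; rewrite gt_min; apply/orP; right; lra.
have := sup_upper_bound hsA Az; rewrite -/s leNgt lt_min sy' /= ltrDl divr_gt0//.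
Qed.

Section Monotonicity.
Variable R : realType.
Variable S : forall n : nat, set (set 'rV[R]_n).
Hypothesis HS : o_minimal_structure S.

Lemma itv_germ (I : interval R) (a : R) : exists2 e : R, 0 < e &
  (forall x, a < x < a + e -> x \in I) \/ (forall x, a < x < a + e -> x \notin I).
Proof.
have L (l : itv_bound R) : exists2 e : R, 0 < e &
   (forall x, a < x < a + e -> (l <= BLeft x)%O) \/
   (forall x, a < x < a + e -> ~~ (l <= BLeft x)%O).
  case: l => [b c|[]]; [|by exists 1 => //; left|by exists 1 => //; right].
  have [ca|ac] := leP c a.
    exists 1 => //; left => x /andP[ax _]; have cx := le_lt_trans ca ax.
    by case: b; rewrite bnd_simp// ltW.
  exists (c - a); first by rewrite subr_gt0.
  right => x; rewrite addrC subrK => /andP[_ xc].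
  by case: b; rewrite bnd_simp -?ltNge -?leNgt// ltW.
have U (l : itv_bound R) : exists2 e : R, 0 < e &
   (forall x, a < x < a + e -> (BRight x <= l)%O) \/
   (forall x, a < x < a + e -> ~~ (BRight x <= l)%O).
  case: l => [b c|[]]; [|by exists 1 => //; right|by exists 1 => //; left].
  have [ca|ac] := leP c a.
    exists 1 => //; right => x /andP[ax _]; have cx := le_lt_trans ca ax.
    by case: b; rewrite bnd_simp -?ltNge -?leNgt// ltW.
  exists (c - a); first by rewrite subr_gt0.
  left => x; rewrite addrC subrK => /andP[_ xc].
  by case: b; rewrite bnd_simp// ltW.
case: I => l u; have [e1 e10 H1] := L l; have [e2 e20 H2] := U u.
exists (Num.min e1 e2); first by rewrite lt_min e10.
have sub x : a < x < a + Num.min e1 e2 -> (a < x < a + e1) /\ (a < x < a + e2).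
  by rewrite -ltrBlDl lt_min !ltrBlDl => /and3P[-> -> ->].
case: H1 => H1; last first.
  by right => x /sub[x1 _]; rewrite itv_boundlr (negPf (H1 _ x1)).
case: H2 => H2; last first.
  by right => x /sub[_ x1]; rewrite itv_boundlr (negPf (H2 _ x1)) andbF.
by left => x /sub[x1 x2]; rewrite itv_boundlr H1// H2.
Qed.

Lemma definable_germ (A : R -> Prop) (a : R) : S [set v : 'rV[R]_1 | A (v 0 0)] ->
  exists2 e : R, 0 < e &
  (forall x, a < x < a + e -> A x) \/ (forall x, a < x < a + e -> ~ A x).
Proof.
have [_ _ _ _ H] := HS; move=> /H[s sE].
have AE x : A x <-> has (fun I => x \in I) s.
  have := congr1 (fun B : set _ => B (const_mx x)) sE.
  by rewrite /mkset !mxE => ->.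
have : exists2 e : R, 0 < e & (forall x, a < x < a + e -> has (fun I => x \in I) s) \/
   (forall x, a < x < a + e -> ~~ has (fun I => x \in I) s).
  elim: s {sE AE} => [|I s [e e0 IH]]; first by exists 1 => //; right.
  have [e' e'0 HI] := itv_germ I a.
  exists (Num.min e e'); first by rewrite lt_min e0.
  have sub x : a < x < a + Num.min e e' -> (a < x < a + e) /\ (a < x < a + e').
    by rewrite -ltrBlDl lt_min !ltrBlDl => /and3P[-> -> ->].
  case: HI => HI; first by left => x /sub[_ /HI]/= ->.
  case: IH => IH; first by left => x /sub[/IH xs _] /=; rewrite xs orbT.
  by right => x /sub[x1 x2] /=; rewrite negb_or HI// IH.
move=> [e e0 He]; exists e => //; case: He => He; [left|right] => x /He.
  by move=> /AE.
by move=> nx /AE; exact/negP.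
Qed.

(** If none of the three held throughout a right-hand neighbourhood, all would fail on a common
    one. *)
Lemma definable_germ3 (A B C : R -> Prop) (a : R) :
  S [set v : 'rV[R]_1 | A (v 0 0)] -> S [set v : 'rV[R]_1 | B (v 0 0)] ->
  S [set v : 'rV[R]_1 | C (v 0 0)] ->
  (exists2 e : R, 0 < e & forall x, a < x < a + e -> [\/ A x, B x | C x]) ->
  exists2 e : R, 0 < e & [\/ forall x, a < x < a + e -> A x,
    forall x, a < x < a + e -> B x | forall x, a < x < a + e -> C x].
Proof.
move=> /(definable_germ a)[e1 e10 H1] /(definable_germ a)[e2 e20 H2].
move=> /(definable_germ a)[e3 e30 H3] [e4 e40 H].
case: H1 => H1; first by exists e1 => //; exact: Or31.
case: H2 => H2; first by exists e2 => //; exact: Or32.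
case: H3 => H3; first by exists e3 => //; exact: Or33.
exfalso; pose e := Num.min (Num.min e1 e2) (Num.min e3 e4).
have e0 : 0 < e by rewrite !lt_min e10 e20 e30.
have : a < a + e / 2 < a + e by apply/andP; split; lra.
rewrite -[X in _ && X]ltrBlDl !lt_min !ltrBlDl => /andP[p /andP[/andP[p1 p2] /andP[p3 p4]]].
by have [] := H (a + e / 2); rewrite ?p//; [apply: H1|apply: H2|apply: H3]; rewrite p.
Qed.

Lemma definable_monotone_germ (g : R -> R) : dfun1 S g -> exists2 e : R, 0 < e &
  (forall x y, 0 < x -> x <= y -> y < e -> g x <= g y) \/
  (forall x y, 0 < x -> x <= y -> y < e -> g y <= g x).
Proof.
move=> dg.
(* In [Rg] and [Lg] alike the first argument of r is the value further to the left. So [rlt] on both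
   sides means increase, while [rgt] on the left with [rlt] on the right means a strict local
   minimum. *)
pose Rg (r : R -> R -> Prop) (x : R) :=
  exists e : R, 0 < e /\ forall y, x < y /\ y < x + e -> r (g x) (g y).
pose Lg (r : R -> R -> Prop) (x : R) :=
  exists e : R, 0 < e /\ forall y, x - e < y /\ y < x -> r (g y) (g x).
have SR r : (forall n (a b : 'rV[R]_n -> R), dfun S a -> dfun S b -> S [set v | r (a v) (b v)]) ->
    S [set v : 'rV[R]_1 | Rg r (v 0 0)] /\ S [set v : 'rV[R]_1 | Lg r (v 0 0)].
  move=> Hr.
  have d1 : dfun S (fun v : 'rV[R]_(1 + 1 + 1) => lsubmx (lsubmx v) 0 0).
    by apply: (dfun_lsub HS 1 (dfun_lsub HS 1 (dfun_coord HS 0))).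
  have d2 : dfun S (fun v : 'rV[R]_(1 + 1 + 1) => lsubmx v 0 (rshift 1 0)).
    exact: (dfun_lsub HS 1 (dfun_coord HS (rshift 1 0))).
  have d3 : dfun S (fun v : 'rV[R]_(1 + 1 + 1) => v 0 (rshift (1 + 1) 0)).
    exact: dfun_coord.
  split; apply: S_ex1 => //; apply: S_and => //.
  - by apply: S_lt => //; [exact: dfun_cst|exact: dfun_coord].
  - apply: S_forall1 => //; apply: S_imp => //.
      apply: S_and => //; apply: S_lt => //; exact: dfunD.
    by apply: Hr; apply: dfun1_comp.
  - by apply: S_lt => //; [exact: dfun_cst|exact: dfun_coord].
  - apply: S_forall1 => //; apply: S_imp => //.
      apply: S_and => //; apply: S_lt => //; exact: dfunB.
    by apply: Hr; apply: dfun1_comp.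
pose rlt (a b : R) : Prop := a < b.
pose rgt (a b : R) : Prop := b < a.
have [Rlt Llt] : S [set v : 'rV[R]_1 | Rg rlt (v 0 0)] /\ S [set v : 'rV[R]_1 | Lg rlt (v 0 0)].
  by apply: SR => n a b da db; exact: S_lt.
have [Rgt Lgt] : S [set v : 'rV[R]_1 | Rg rgt (v 0 0)] /\ S [set v : 'rV[R]_1 | Lg rgt (v 0 0)].
  by apply: SR => n a b da db; exact: S_lt.
have [Req Leq] : S [set v : 'rV[R]_1 | Rg eq (v 0 0)] /\ S [set v : 'rV[R]_1 | Lg eq (v 0 0)].
  by apply: SR => n a b da db; exact: S_eqr.
have triR x : [\/ Rg rlt x, Rg rgt x | Rg eq x].
  have [||||e e0 H] := @definable_germ3 (fun y => rlt (g x) (g y))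
    (fun y => rgt (g x) (g y)) (fun y => g x = g y) x.
  - by apply: S_lt => //; exact: dfun_cst.
  - by apply: S_lt => //; exact: dfun_cst.
  - by apply: S_eqr => //; exact: dfun_cst.
  - by exists 1 => // y _; rewrite /rlt /rgt; case: ltgtP => ?;
      [exact: Or31|exact: Or32|exact: Or33].
  by case: H => H; [apply: Or31|apply: Or32|apply: Or33]; exists e; split => // y [y1 y2];
    apply: H; rewrite y1.
(* Germs are taken to the right, so the left-hand trichotomy is that of y -> g (- y) at - x. *)
have triL x : [\/ Lg rlt x, Lg rgt x | Lg eq x].
  have dgN : dfun S (fun v : 'rV[R]_1 => g (- v 0 0)).
    by apply: dfun1_comp => //; apply: dfunN => //; exact: dfun_coord.
  have [||||e e0 H] := @definable_germ3 (fun y => rlt (g (- y)) (g x))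
     (fun y => rgt (g (- y)) (g x))
     (fun y => g (- y) = g x) (- x).
  - by apply: S_lt => //; exact: dfun_cst.
  - by apply: S_lt => //; exact: dfun_cst.
  - by apply: S_eqr => //; exact: dfun_cst.
  - by exists 1 => // y _; rewrite /rlt /rgt; case: ltgtP => ?;
      [exact: Or31|exact: Or32|exact: Or33].
  by case: H => H; [apply: Or31|apply: Or32|apply: Or33]; exists e; split => // y [y1 y2];
    rewrite -(opprK y); apply: H; apply/andP; split; lra.
(* Applied to the sets of points of each type, the trichotomy near 0+ yields one right-hand and one
   left-hand relation valid at all points of an interval: nine cases. *)
have [|e1 e10 HR] := @definable_germ3 _ _ _ 0 Rlt Rgt Req; first by exists 1.
have [|e2 e20 HL] := @definable_germ3 _ _ _ 0 Llt Lgt Leq; first by exists 1.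
rewrite !add0r in HR HL.
exists (Num.min e1 e2); first by rewrite lt_min e10.
set e := Num.min e1 e2; have e0 : 0 < e by rewrite lt_min e10.
have sub x : 0 < x < e -> 0 < x < e1 /\ 0 < x < e2.
  by rewrite lt_min => /and3P[-> -> ->].
have {}HR : [\/ forall x, 0 < x < e -> Rg rlt x, forall x, 0 < x < e -> Rg rgt x |
   forall x, 0 < x < e -> Rg eq x].
  by case: HR => H; [apply: Or31|apply: Or32|apply: Or33] => x /sub[/H].
have {}HL : [\/ forall x, 0 < x < e -> Lg rlt x, forall x, 0 < x < e -> Lg rgt x |
   forall x, 0 < x < e -> Lg eq x].
  by case: HL => H; [apply: Or31|apply: Or32|apply: Or33] => x /sub[_ /H].
have weakR r (r' : R -> R -> Prop) : (forall a b, r a b -> r' a b) ->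
    (forall x, 0 < x < e -> Rg r x) -> forall x, 0 < x < e ->
    exists2 e : R, 0 < e & forall y, x < y < x + e -> r' (g x) (g y).
  move=> rr' H x /H[k [k0 Hk]]; exists k => // y /andP[y1 y2]; exact/rr'/Hk.
have weakL r (r' : R -> R -> Prop) : (forall a b, r a b -> r' a b) ->
    (forall x, 0 < x < e -> Lg r x) -> forall x, 0 < x < e ->
    exists2 e : R, 0 < e & forall y, x - e < y < x -> r' (g y) (g x).
  move=> rr' H x /H[k [k0 Hk]]; exists k => // y /andP[y1 y2]; exact/rr'/Hk.
have nd r1 r2 : (forall a b : R, r1 a b -> a <= b) -> (forall a b : R, r2 a b -> a <= b) ->
    (forall x, 0 < x < e -> Rg r1 x) -> (forall x, 0 < x < e -> Lg r2 x) ->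
    forall x y, 0 < x -> x <= y -> y < e -> g x <= g y.
  by move=> H1 H2 h1 h2; apply: local_nondecr; [exact: weakR H1 h1|exact: weakL H2 h2].
have ni r1 r2 : (forall a b : R, r1 a b -> b <= a) -> (forall a b : R, r2 a b -> b <= a) ->
    (forall x, 0 < x < e -> Rg r1 x) -> (forall x, 0 < x < e -> Lg r2 x) ->
    forall x y, 0 < x -> x <= y -> y < e -> g y <= g x.
  move=> H1 H2 h1 h2 x y x0 xy ye; rewrite -lerN2; move: x y x0 xy ye.
  apply: (@local_nondecr R (fun x => - g x)).
    by apply: (weakR r1 (fun a b => - a <= - b)) h1 => a b /H1; rewrite lerN2.
  by apply: (weakL r2 (fun a b => - a <= - b)) h2 => a b /H2; rewrite lerN2.
(* Constancy just to the right of e / 2 gives points z < y there with g z = g y and z as close to y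
   as wished, so the left-hand relation at y relates a value to itself. This excludes the strict
   relations. *)
have noRL r1 : (forall x, 0 < x < e -> Rg eq x) -> (forall x, 0 < x < e -> Lg r1 x) ->
    exists a, r1 a a.
  move=> h1 h2.
  have [|k [k0 Hk]] := h1 (e / 2); first by apply/andP; split; lra.
  pose y := e / 2 + Num.min (k / 2) (e / 4).
  have m0 : 0 < Num.min (k / 2) (e / 4) by rewrite lt_min; apply/andP; split; lra.
  have m1 : Num.min (k / 2) (e / 4) <= k / 2 by rewrite ge_min lexx.
  have m2 : Num.min (k / 2) (e / 4) <= e / 4 by rewrite ge_min lexx orbT.
  have [|j [j0 Hj]] := h2 y; first by rewrite /y; apply/andP; split; lra.
  pose z := Num.max (y - j / 2) (e / 2 + Num.min (k / 2) (e / 4) / 2).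
  have z1 : y - j / 2 <= z by rewrite le_max lexx.
  have z2 : e / 2 + Num.min (k / 2) (e / 4) / 2 <= z by rewrite le_max lexx orbT.
  have z3 : z < y by rewrite gt_max /y; apply/andP; split; lra.
  exists (g (e / 2)).
  have Ey : g (e / 2) = g y by apply: Hk; rewrite /y; split; lra.
  have Ez : g (e / 2) = g z by apply: Hk; move: z3; rewrite /y; split; lra.
  by rewrite {1}Ez Ey; apply: Hj; split; lra.
have noLR r1 : (forall x, 0 < x < e -> Rg r1 x) -> (forall x, 0 < x < e -> Lg eq x) ->
    exists a, r1 a a.
  move=> h1 h2.
  have [|k [k0 Hk]] := h2 (e / 2); first by apply/andP; split; lra.
  pose y := e / 2 - Num.min (k / 2) (e / 4).
  have m0 : 0 < Num.min (k / 2) (e / 4) by rewrite lt_min; apply/andP; split; lra.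
  have m1 : Num.min (k / 2) (e / 4) <= k / 2 by rewrite ge_min lexx.
  have m2 : Num.min (k / 2) (e / 4) <= e / 4 by rewrite ge_min lexx orbT.
  have [|j [j0 Hj]] := h1 y; first by rewrite /y; apply/andP; split; lra.
  pose z := Num.min (y + j / 2) (e / 2 - Num.min (k / 2) (e / 4) / 2).
  have z1 : z <= y + j / 2 by rewrite ge_min lexx.
  have z2 : z <= e / 2 - Num.min (k / 2) (e / 4) / 2 by rewrite ge_min lexx orbT.
  have z3 : y < z by rewrite lt_min /y; apply/andP; split; lra.
  exists (g (e / 2)).
  have Ey : g y = g (e / 2) by apply: Hk; rewrite /y; split; lra.
  have Ez : g z = g (e / 2) by apply: Hk; move: z3; rewrite /y; split; lra.
  by rewrite -{1}Ey -Ez; apply: Hj; split; lra.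
(* Opposite strict relations on the two sides would make every point a strict local minimum, of g or
   of - g. *)
have extr (h : R -> R) :
    (forall x, 0 < x < e -> exists2 e : R, 0 < e & forall y, x < y < x + e -> h x < h y) ->
    (forall x, 0 < x < e -> exists2 e : R, 0 < e & forall y, x - e < y < x -> h x < h y) -> False.
  move=> h1 h2; apply: (@strict_local_min_contra R h e e0) => x xe.
  have [k1 k10 Hk1] := h1 _ xe; have [k2 k20 Hk2] := h2 _ xe.
  exists (Num.min k1 k2); first by rewrite lt_min k10.
  move=> y yx; rewrite lt_min !ltr_norml => /andP[/andP[? ?] /andP[? ?]].
  move: yx; rewrite neq_lt => /orP[yx|yx]; [apply: Hk2|apply: Hk1]; apply/andP; split; lra.
have leW (a b : R) : a < b -> a <= b by exact: ltW.
have leE (a b : R) : a = b -> a <= b by move=> ->.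
have leE' (a b : R) : a = b -> b <= a by move=> ->.
case: HR => HR; case: HL => HL.
- by left; apply: nd HR HL.
- exfalso; apply: (extr g); first by apply: (weakR rlt (fun a b => a < b)) HR.
  by apply: (weakL rgt (fun a b => b < a)) HL.
- by have [a] := noLR _ HR HL; rewrite /rlt ltxx.
- exfalso; apply: (extr (fun x => - g x)).
    by apply: (weakR rgt (fun a b => - a < - b)) HR => a b; rewrite ltrN2.
  by apply: (weakL rlt (fun a b => - b < - a)) HL => a b; rewrite ltrN2.
- by right; apply: (ni rgt rgt) => // a b /ltW.
- by have [a] := noLR _ HR HL; rewrite /rgt ltxx.
- by have [a] := noRL _ HR HL; rewrite /rlt ltxx.
- by have [a] := noRL _ HR HL; rewrite /rgt ltxx.
- by left; apply: nd HR HL.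
Qed.

End Monotonicity.

(** * Kurdyka's inequality *)

Section Desingularization.
Variable R : realType.
Variable S : forall n : nat, set (set 'rV[R]_n).
Hypothesis HS : o_minimal_structure S.
Variable n : nat.
Implicit Types (E N q : 'rV[R]_n -> R) (M : R -> 'rV[R]_n -> Prop).

Definition argmin_in q M (t : R) (z : 'rV[R]_n) :=
  M t z /\ forall z', M t z' -> q z <= q z'.

Definition dfamily M := S [set v : 'rV[R]_(1 + n) | M (v 0 (lshift n 0)) (rsubmx v)].

Lemma dfamily_subst m M (a : 'rV[R]_m -> R) (b : 'rV[R]_m -> 'rV[R]_n) : dfamily M ->
  dfun S a -> (forall i, dfun S (fun v => b v 0 i)) -> S [set v | M (a v) (b v)].
Proof.
move=> SM da db.
have := @S_preimage R S HS m (1 + n) (fun v => row_mx (const_mx (a v)) (b v)) _ _ SM.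
move=> H; apply: S_eq (H _) => [v|i]; first by rewrite row_mxEl mxE row_mxKr.
rewrite -(splitK i); case: (fintype.split i) => j /=.
  by apply: eq_dfun da => v; rewrite row_mxEl mxE.
by apply: eq_dfun (db j) => v; rewrite row_mxEr.
Qed.

Lemma dfamily_argmin q M : dfun S q -> dfamily M -> dfamily (argmin_in q M).
Proof.
move=> dq SM; apply: S_and => //; apply: S_forall => //; apply: S_imp => //.
  apply: dfamily_subst => //.
    exact: (dfun_lsub HS n (dfun_coord HS (lshift n 0))).
  move=> i; exact: (dfun_rsub HS (1 + n) (dfun_coord HS i)).
apply: S_le => //; last exact: (dfun_rsub HS (1 + n) dq).
exact: (dfun_lsub HS n (dfun_rsub HS 1 dq)).
Qed.

Lemma compact_argmin q M t : continuous q -> compact [set z | M t z] ->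
  compact [set z | argmin_in q M t z].
Proof.
move=> cq cM.
have -> : [set z | argmin_in q M t z] =
    [set z | M t z] `&` \bigcap_(z' in [set z | M t z]) (q @^-1` [set x | x <= q z']).
  by apply/seteqP; split => z.
apply: compact_closedI => //; apply: closed_bigI => z' _.
by apply: closed_comp => [x _|]; [exact: cq|exact: closed_le].
Qed.

Lemma argmin_nonempty q M t z : continuous q -> compact [set z | M t z] ->
  M t z -> exists z', argmin_in q M t z'.
Proof.
move=> cq cM Mz.
have [|//||c /[!inE] Mc H] := @compact_EVT_min _ R q [set z | M t z].
- by exists z.
- exact: continuous_subspaceT.
- by exists c; split => // z' Mz'; apply: H; rewrite inE.
Qed.

(** With all coordinates among [qs] the remaining fibres have at most one point: a definable choice
    obtained by minimisation alone. Fibres stay compact at each stage, which is why no nonempty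
    fibre becomes empty. *)
Lemma iterated_argmin M (qs : seq ('rV[R]_n -> R)) :
  dfamily M -> (forall t, compact [set z | M t z]) ->
  (forall q, List.In q qs -> dfun S q /\ continuous q) ->
  exists M', [/\ dfamily M', (forall t z, M' t z -> M t z),
    (forall t z, M t z -> exists z', M' t z') &
    (forall t q, List.In q qs -> forall z z', M' t z -> M' t z' -> q z = q z')].
Proof.
elim: qs M => [|q qs IH] M dM cM Hq; first by exists M; split => // t z Mz; exists z.
have [dq cq] := Hq q (or_introl erefl).
have [||q' Hq'|M' [dM' subM' neM' eqM']] := IH (argmin_in q M).
- exact: dfamily_argmin.
- by move=> t; exact: compact_argmin.
- by apply: Hq; right.
exists M'; split => //.
- by move=> t z /subM'[].
- move=> t z Mz; have [z' Mz'] := argmin_nonempty cq (cM t) Mz.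
  exact: neM' Mz'.
- move=> t q' [<-|q'qs] z z'; last exact: eqM'.
  move=> /subM'[Mz Hz] /subM'[Mz' Hz']; apply/eqP; rewrite eq_le.
  by rewrite Hz// Hz'.
Qed.

Lemma definable_min_curve E N (B : R) :
  dfun S E -> dfun S N -> continuous E -> continuous N ->
  exists c : R -> 'rV[R]_n, (forall i, dfun1 S (fun t => c t 0 i)) /\
    forall z, `|z| <= B -> [/\ `|c (E z)| <= B, E (c (E z)) = E z & N (c (E z)) <= N z].
Proof.
move=> dE dN cE cN.
(* The ball of the maximum norm written as a box, so that its definability needs no absolute
   value. *)
pose M0 (t : R) (z : 'rV[R]_n) := (forall i, - B <= z 0 i /\ z 0 i <= B) /\ E z = t.
have dcoord i : dfun S (fun v : 'rV[R]_(1 + n) => rsubmx v 0 i).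
  exact: (dfun_rsub HS 1 (dfun_coord HS i)).
have dM0 : dfamily M0.
  apply: S_and => //.
    apply: S_forall_ord => // i; apply: S_and => //; apply: S_le => //; exact: dfun_cst.
  apply: S_eqr => //; last exact: dfun_coord.
  exact: (dfun_rsub HS 1 dE).
have M0E t z : 0 <= B -> M0 t z <-> `|z| <= B /\ E z = t.
  move=> B0; split => -[H1 H2]; split => //.
    by apply: norm_le_coord => // i; rewrite ler_norml; have [-> ->] := H1 i.
  by move=> i; apply/andP; rewrite -ler_norml; apply: le_trans H1; exact: coord_le_norm.
(* For B < 0 the ball is empty and any definable curve will do. *)
have [B0|B0] := leP 0 B; last first.
  exists (fun=> 0); split => [i|z zB]; last first.
    by have := le_lt_trans zB B0; rewrite normr_lt0.
  by apply: eq_dfun (dfun_cst HS 1 0) => v; rewrite mxE.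
have cM0 t : compact [set z | M0 t z].
  have -> : [set z | M0 t z] = [set z | `|z| <= B] `&` (E @^-1` [set x | x = t]).
    by apply/seteqP; split => z; rewrite /= M0E.
  apply: compact_closedI; first exact: closed_ball_compact.
  by apply: closed_comp => [x _|]; [exact: cE|exact: closed_eq].
have [M' [dM' subM' neM' eqM']] : exists M',
    [/\ dfamily M', (forall t z, M' t z -> argmin_in N M0 t z),
    (forall t z, argmin_in N M0 t z -> exists z', M' t z') &
    (forall t q, List.In q [seq (fun z : 'rV[R]_n => z 0 i) | i <- enum 'I_n] ->
       forall z z', M' t z -> M' t z' -> q z = q z')].
  apply: iterated_argmin; [exact: dfamily_argmin|by move=> t; exact: compact_argmin|].
  move=> q /List.in_map_iff[i [<- _]]; split; first exact: dfun_coord.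
  exact: coord_continuous.
have uniqM' t z z' : M' t z -> M' t z' -> z = z'.
  move=> Mz Mz'; apply/rowP => i.
  apply: (eqM' t (fun z : 'rV[R]_n => z 0 i)) => //.
  apply/List.in_map_iff; exists i; split => //.
  have : i \in enum 'I_n by rewrite mem_enum.
  elim: (enum 'I_n) => //= j s IH; rewrite inE => /predU1P[->|/IH]; by [left|right].
(* Over a t with empty fibre the curve takes the default value 0, whence the two alternatives in the
   formula for its graph. *)
pose c t := xget 0 [set z | M' t z].
have cP t z : M' t z -> c t = z.
  by move=> Mz; rewrite /c; apply: xget_unique => // z' Mz'; exact: uniqM' Mz' Mz.
exists c; split => [i|z zB].
  apply: (@dfun_graph R S 1 _ (fun v y =>
     (exists z : 'rV[R]_n, M' (v 0 0) z /\ z 0 i = y) \/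
     (~ (exists z : 'rV[R]_n, M' (v 0 0) z) /\ y = 0))).
    move=> v y; split.
      move=> [[z [Mz <-]]|[nM ->]]; first by rewrite (cP _ _ Mz).
      rewrite /c; case: xgetP => [z _ Mz|_]; last by rewrite mxE.
      by exfalso; apply: nM; exists z.
    move=> ->; have [[z Mz]|nM] := pselect (exists z : 'rV[R]_n, M' (v 0 0) z).
      by left; exists z; rewrite (cP _ _ Mz).
    right; split => //; rewrite /c; case: xgetP => [z _ Mz|_]; last by rewrite mxE.
    by exfalso; apply: nM; exists z.
  have SM : S [set v : 'rV[R]_(1 + 1 + n) | M' (lsubmx (lsubmx v) 0 0) (rsubmx v)].
    apply: dfamily_subst => //.
      exact: (dfun_lsub HS n (dfun_lsub HS 1 (dfun_coord HS 0))).
    by move=> j; exact: (dfun_rsub HS (1 + 1) (dfun_coord HS j)).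
  apply: S_or => //.
    apply: (@S_ex R S HS (1 + 1) n (fun v z => M' (lsubmx v 0 0) z /\ z 0 i = v 0 (rshift 1 0))).
    apply: S_and => //; apply: S_eqr => //.
      exact: (dfun_rsub HS (1 + 1) (dfun_coord HS i)).
    exact: (dfun_lsub HS n (dfun_coord HS (rshift 1 0))).
  apply: S_and => //.
    apply: S_not => //.
    exact: (@S_ex R S HS (1 + 1) n (fun v z => M' (lsubmx v 0 0) z)).
  by apply: S_eqr => //; [exact: dfun_coord|exact: dfun_cst].
have M0z : M0 (E z) z by apply/M0E.
have [z1 Az1] := argmin_nonempty cN (cM0 _) M0z.
have [z2 Mz2] := neM' _ _ Az1.
rewrite (cP _ _ Mz2); have [/(M0E _ _ B0)[z2B z2E] H] := subM' _ _ Mz2.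
by split => //; exact: H.
Qed.

(* N is the squared gradient norm of E; the last clause says that the slope of
   psi at s is at least the inverse of the least gradient norm on {E = s}. *)
Lemma desingularize E N (D : 'I_n -> 'rV[R]_n -> R) (B : R) :
  dfun S E -> dfun S N -> continuous E -> continuous N ->
  (forall z, N z = \sum_i D i z ^+ 2) ->
  (forall z (e : R), 0 < e -> exists2 r : R, 0 < r & forall z', `|z' - z| < r ->
    `|E z' - E z - \sum_i D i z * (z' 0 i - z 0 i)| <= e * \sum_i `|z' 0 i - z 0 i|) ->
  exists (psi : R -> R) (eps K : R), [/\ 0 < eps,
    (forall s t, 0 < s -> s <= t -> t < eps -> psi s <= psi t),
    (forall z, `|z| <= B -> `|psi (E z)| <= K) &
    (forall z (e : R), `|z| <= B -> 0 < E z < eps -> 0 < e ->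
      exists2 dl : R, 0 < dl & forall z', `|z'| <= B -> 0 < E z' -> E z' <= E z ->
        E z - E z' < dl ->
        E z - E z' <= (Num.sqrt (N z) + e) * (psi (E z) - psi (E z')))].
Proof.
move=> dE dN cE cN NE HD.
have [c [dc Hc]] := definable_min_curve B dE dN cE cN.
(* Signs turn each coordinate of c, monotone near 0+, into a nondecreasing one; the increments of
   their sum [psi] are then exactly the l1 distances between points of c. *)
have /exists2_choice[e0 e00 He0] : forall i, exists2 e : R, 0 < e &
    (exists s : R, `|s| = 1 /\ forall x y, 0 < x -> x <= y -> y < e -> s * c x 0 i <= s * c y 0 i).
  move=> i; have [e e0 [H|H]] := definable_monotone_germ HS (dc i); exists e => //.
    by exists 1; split; [rewrite normr1|move=> x y ? ? ?; rewrite !mul1r H].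
  by exists (-1); split; [rewrite normrN1|move=> x y ? ? ?; rewrite !mulN1r lerN2 H].
have /choice[s Hs] := He0.
have [eps eps0 Heps] : exists2 e : R, 0 < e & forall i, e <= e0 i.
  apply: (@common_radius R _ (fun i e => e <= e0 i)) => [i a b|i]; first exact: le_trans.
  by exists (e0 i).
have mono i x y : 0 < x -> x <= y -> y < eps -> s i * c x 0 i <= s i * c y 0 i.
  move=> x0 xy ye; have [_] := Hs i; apply => //; exact: lt_le_trans (Heps i).
pose psi t := \sum_i s i * c t 0 i.
have psiB x y : 0 < x -> x <= y -> y < eps ->
    psi y - psi x = \sum_i `|c x 0 i - c y 0 i|.
  move=> x0 xy ye; rewrite /psi -sumrB; apply: eq_bigr => i _.
  have [s1 _] := Hs i.
  rewrite -[RHS]mul1r -s1 -normrM mulrBr distrC ger0_norm// subr_ge0; exact: mono.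
exists psi, eps, (\sum_(i < n) B); split => //.
- by move=> x y x0 xy ye; rewrite -subr_ge0 psiB// sumr_ge0.
- move=> z zB; apply: le_trans (ler_norm_sum _ _ _) _; apply: ler_sum => i _.
  have [cB _ _] := Hc _ zB; have [s1 _] := Hs i.
  by rewrite normrM s1 mul1r; apply: le_trans cB; exact: coord_le_norm.
move=> z e zB /andP[Ez0 Ezeps] ep; set t := E z.
have [cB cE' cN'] := Hc _ zB.
have e2 : 0 < e / 2 by lra.
have [r r0 Hr] := HD (c t) (e / 2) e2.
have sN : Num.sqrt (N (c t)) <= Num.sqrt (N z) by rewrite ler_wsqrtr.
have q0 : 0 <= Num.sqrt (N z) by exact: sqrtr_ge0.
have qe : 0 < Num.sqrt (N z) + e by lra.
(* If c moves by at least r between t' and t, then psi differs by at least r and this radius settles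
   the claim. Otherwise the expansion of E at c t applies, together with N (c t) <= N z. *)
exists ((Num.sqrt (N z) + e) * r); first by rewrite mulr_gt0.
move=> z' z'B Ez'0 Ez'z; set t' := E z' in Ez'0 Ez'z *; move=> tt'.
have [c'B c'E' _] := Hc _ z'B.
rewrite psiB//; set W := \sum_i _.
have [far|near_] := leP r `|c t' - c t|.
  apply: le_trans (ltW tt') _; rewrite ler_pM2l//; apply: le_trans far _.
  apply: norm_le_coord => [|i]; first exact: sumr_ge0.
  by rewrite !mxE /W (bigD1 i)//= lerDl sumr_ge0.
have := Hr _ near_; rewrite c'E' cE' -/t -/t' -/W => H.
have W0 : 0 <= W by exact: sumr_ge0.
have H2 : `|\sum_i D i (c t) * (c t' 0 i - c t 0 i)| <= Num.sqrt (N (c t)) * W.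
  apply: le_trans (ler_norm_sum _ _ _) _; rewrite /W mulr_sumr; apply: ler_sum => i _.
  rewrite normrM ler_wpM2r// -sqrtr_sqr ler_wsqrtr// NE (bigD1 i)//= lerDl.
  by apply: sumr_ge0 => j _; exact: sqr_ge0.
move: H H2; rewrite !ler_norml => /andP[h1 h2] /andP[h3 h4].
nra.
Qed.

End Desingularization.

Lemma ler_sqr_norm (R : realType) (a b : R) : (a ^+ 2 <= b ^+ 2) = (`|a| <= `|b|).
Proof.
by rewrite -(real_normK (num_real a)) -(real_normK (num_real b)) ler_pXn2r// nnegrE.
Qed.

Lemma continuous_funcomp (U V W : topologicalType) (h : U -> V) (g : V -> W) :
  continuous h -> continuous g -> continuous (fun x => g (h x)).
Proof. by move=> ch cg x; apply: (@continuous_comp _ _ _ h g); [exact: ch|exact: cg]. Qed.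

Lemma lsubmx_continuous (R : realType) m n :
  continuous (fun z : 'rV[R]_(m + n) => lsubmx z).
Proof.
apply: continuous_row => i.
rewrite (_ : (fun t => _) = fun t : 'rV[R]_(m + n) => t 0 (lshift n i)).
  exact: coord_continuous.
by apply/funext => t; rewrite mxE.
Qed.

Lemma rsubmx_continuous (R : realType) m n :
  continuous (fun z : 'rV[R]_(m + n) => rsubmx z).
Proof.
apply: continuous_row => i.
rewrite (_ : (fun t => _) = fun t : 'rV[R]_(m + n) => t 0 (rshift m i)).
  exact: coord_continuous.
by apply/funext => t; rewrite mxE.
Qed.

(** * The energy on the phase space and its definability *)

Section DefinableEnergy.
Variable R : realType.
Variable S : forall n : nat, set (set 'rV[R]_n).
Hypothesis HS : o_minimal_structure S.
Variable d : nat.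
Variable f : 'rV[R]_d -> R.
Hypothesis Cf : C1 f.
Hypothesis df : dfun S f.

(** The derivative is singled out by its epsilon-delta formula, whose quantifiers range over real
    numbers; squares replace absolute values. *)
Lemma dfun_pd (i : 'I_d) : dfun S (pd f i).
Proof.
apply: (@dfun_graph R S d _ (fun u y => forall e : R, 0 < e -> exists dl : R, 0 < dl /\
   forall h : R, - dl < h /\ h < dl ->
     (f (u + h *: evec R i) - f u - y * h) ^+ 2 <= e ^+ 2 * h ^+ 2)).
  move=> u y; transitivity (is_derive (0 : R) 1 (fun h : R => f (u + h *: evec R i)) y); last first.
    split => [/is_derive_derive1 <-//|->].
    by have [dif _] := Cf; have /derivable_is_derive1 := dif i u.
  rewrite is_derive_distP; split => H e e0.
    have [dl [dl0 Hdl]] := H e e0; exists dl => // h; rewrite subr0 ltr_norml => /andP hdl.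
    rewrite scale0r addr0; have := Hdl h hdl.
    by rewrite -exprMn ler_sqr_norm [in leRHS]normrM (gtr0_norm e0).
  have [dl dl0 Hdl] := H e e0; exists dl; split => // h hdl.
  have := Hdl h; rewrite subr0 ltr_norml scale0r addr0 => /(_ (introT andP hdl)) Hh.
  by rewrite -exprMn ler_sqr_norm [in leRHS]normrM (gtr0_norm e0).
have cst0 m : dfun S (fun v : 'rV[R]_m => 0) by exact: dfun_cst.
apply: S_forall1 => //; apply: S_imp => //.
  by apply: S_lt => //; exact: dfun_coord.
apply: S_ex1 => //; apply: S_and => //.
  by apply: S_lt => //; exact: dfun_coord.
(* Each quantifier appends its variable on the right, so a point of the ambient space reads (u, y,
   e, dl, h). *)
have dh : dfun S (fun v : 'rV[R]_(d + 1 + 1 + 1 + 1) => v 0 (rshift (d + 1 + 1 + 1) 0)).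
  exact: dfun_coord.
have ddl : dfun S (fun v : 'rV[R]_(d + 1 + 1 + 1 + 1) => lsubmx v 0 (rshift (d + 1 + 1) 0)).
  exact: (dfun_lsub HS 1 (dfun_coord HS (rshift (d + 1 + 1) 0))).
have de : dfun S (fun v : 'rV[R]_(d + 1 + 1 + 1 + 1) => lsubmx (lsubmx v) 0 (rshift (d + 1) 0)).
  exact: (dfun_lsub HS 1 (dfun_lsub HS 1 (dfun_coord HS (rshift (d + 1) 0)))).
have dy : dfun S (fun v : 'rV[R]_(d + 1 + 1 + 1 + 1) => lsubmx (lsubmx (lsubmx v)) 0 (rshift d 0)).
  exact: (dfun_lsub HS 1 (dfun_lsub HS 1 (dfun_lsub HS 1 (dfun_coord HS (rshift d 0))))).
have du (g : 'rV[R]_d -> R) : dfun S g ->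
    dfun S (fun v : 'rV[R]_(d + 1 + 1 + 1 + 1) => g (lsubmx (lsubmx (lsubmx (lsubmx v))))).
  by move=> dg; exact: (dfun_lsub HS 1 (dfun_lsub HS 1 (dfun_lsub HS 1 (dfun_lsub HS 1 dg)))).
apply: S_forall1 => //; apply: S_imp => //.
  by apply: S_and => //; apply: S_lt => //; exact: dfunN.
apply: S_le => //; last by apply: dfunM => //; exact: dfunX2.
apply: dfunX2 => //; apply: dfunB => //; last exact: dfunM.
apply: dfunB => //; last exact: du.
apply: (dfun_comp HS (G := fun v : 'rV[R]_(d + 1 + 1 + 1 + 1) =>
  lsubmx (lsubmx (lsubmx (lsubmx v))) + v 0 (rshift (d + 1 + 1 + 1) 0) *: evec R i)) => // j.
have := dfunD HS (du _ (dfun_coord HS j)) (dfunM HS dh (dfun_cst HS _ (evec R i 0 j))).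
by apply: eq_dfun => v; rewrite !mxE.
Qed.

Definition energy (z : 'rV[R]_(d + d)) : R :=
  f (lsubmx z) + (\sum_j rsubmx z 0 j ^+ 2) / 2.

(** The gradient of [energy] written out; the second block is w itself, the gradient of |w|^2 /
    2. *)
Definition denergy (i : 'I_(d + d)) (z : 'rV[R]_(d + d)) : R :=
  match fintype.split i with inl j => pd f j (lsubmx z) | inr j => rsubmx z 0 j end.

Lemma sum_denergy (h : 'I_(d + d) -> R -> R) z :
  \sum_i h i (denergy i z) = \sum_i h (lshift d i) (pd f i (lsubmx z)) +
    \sum_i h (rshift d i) (rsubmx z 0 i).
Proof.
rewrite big_split_ord /=; congr (_ + _); apply: eq_bigr => i _; rewrite /denergy.
  by rewrite (unsplitK (inl i)).
by rewrite (unsplitK (inr i)).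
Qed.

Lemma energy_first_order z (e : R) : 0 < e -> exists2 r : R, 0 < r & forall z', `|z' - z| < r ->
    `|energy z' - energy z - \sum_i denergy i z * (z' 0 i - z 0 i)| <= e * \sum_i `|z' 0 i - z 0 i|.
Proof.
move=> e0; have [r r0 Hr] := first_order (lsubmx z) Cf e0.
(* The quadratic part has the exact remainder |w' - w|^2 / 2, which the bound e on the distance
   turns into a linear one. *)
exists (Num.min r e); first by rewrite lt_min r0.
move=> z'; rewrite lt_min => /andP[z'r z'e].
have dist i : `|z' 0 i - z 0 i| <= `|z' - z| by have := coord_le_norm (z' - z) i; rewrite !mxE.
rewrite (sum_denergy (fun i x => x * (z' 0 i - z 0 i))) big_split_ord /= mulrDr.
have -> : energy z' - energy z -
    (\sum_i pd f i (lsubmx z) * (z' 0 (lshift d i) - z 0 (lshift d i)) +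
    \sum_i rsubmx z 0 i * (z' 0 (rshift d i) - z 0 (rshift d i))) =
  (f (lsubmx z') - f (lsubmx z) - \sum_i pd f i (lsubmx z) * (lsubmx z' 0 i - lsubmx z 0 i)) +
  \sum_i (z' 0 (rshift d i) - z 0 (rshift d i)) ^+ 2 / 2.
  have -> : \sum_i pd f i (lsubmx z) * (lsubmx z' 0 i - lsubmx z 0 i) =
     \sum_i pd f i (lsubmx z) * (z' 0 (lshift d i) - z 0 (lshift d i)).
    by apply: eq_bigr => i _; rewrite !mxE.
  rewrite /energy; set a := \sum_i pd f i _ * _.
  suff : (\sum_j rsubmx z' 0 j ^+ 2) / 2 - (\sum_j rsubmx z 0 j ^+ 2) / 2 -
    \sum_i rsubmx z 0 i * (z' 0 (rshift d i) - z 0 (rshift d i)) =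
    \sum_i (z' 0 (rshift d i) - z 0 (rshift d i)) ^+ 2 / 2 by move=> <-; ring.
  rewrite !mulr_suml -!sumrB; apply: eq_bigr => i _; rewrite !mxE.
  by field.
apply: le_trans (ler_normD _ _) _; apply: lerD.
  apply: le_trans (Hr _ _) _.
    apply: le_lt_trans z'r; apply: norm_le_coord => // i; rewrite !mxE; exact: dist.
  rewrite ler_wpM2l ?(ltW e0)//; apply: ler_sum => i _; by rewrite !mxE.
apply: le_trans (ler_norm_sum _ _ _) _; rewrite mulr_sumr; apply: ler_sum => i _.
have := dist (rshift d i); set x := z' _ _ - _ => xz.
rewrite normrM normrX expr2 -mulrA mulrC ler_wpM2r// (ger0_norm (_ : 0 <= 2^-1))//.
by have := normr_ge0 x; lra.
Qed.

Lemma energy_continuous : continuous energy.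
Proof.
have c1 : continuous (fun z : 'rV[R]_(d + d) => f (lsubmx z)).
  exact: (continuous_funcomp (@lsubmx_continuous R d d) (C1_continuous Cf)).
have c2 : continuous (fun z : 'rV[R]_(d + d) => \sum_j rsubmx z 0 j ^+ 2).
  apply: continuous_sum => j; apply: continuous_sqr.
  by apply: continuous_coord; exact: rsubmx_continuous.
by move=> z; apply: cvgD (c1 z) _; apply: cvgMr_tmp (c2 z).
Qed.

Lemma denergy_continuous i : continuous (denergy i).
Proof.
have [_ cf] := Cf; rewrite /denergy; case: fintype.split => j.
  exact: (continuous_funcomp (@lsubmx_continuous R d d) (cf j)).
by apply: continuous_coord; exact: rsubmx_continuous.
Qed.

(** [desingularize] speaks of levels near 0+. Here V is to be the limit of the energy along a
    trajectory, and B a bound for its phase curve. *)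
Lemma kurdyka_energy (B V : R) :
  exists (psi : R -> R) (eps K : R), [/\ 0 < eps,
    (forall s t, 0 < s -> s <= t -> t < eps -> psi s <= psi t),
    (forall z, `|z| <= B -> `|psi (energy z - V)| <= K) &
    (forall z (e : R), `|z| <= B -> 0 < energy z - V < eps -> 0 < e ->
      exists2 dl : R, 0 < dl & forall z', `|z'| <= B -> 0 < energy z' - V ->
        energy z' <= energy z -> energy z - energy z' < dl ->
        energy z - energy z' <= (Num.sqrt (\sum_i denergy i z ^+ 2) + e) *
           (psi (energy z - V) - psi (energy z' - V)))].
Proof.
have dE : dfun S energy.
  apply: dfunD => //; first exact: (dfun_lsub HS d df).
  apply: dfunM => //; last exact: dfun_cst.
  apply: dfun_sum => // i; apply: dfunX2 => //.
  exact: (dfun_rsub HS d (dfun_coord HS i)).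
have dN : dfun S (fun z => \sum_i denergy i z ^+ 2).
  apply: dfun_sum => // i; apply: dfunX2 => //; rewrite /denergy.
  case: fintype.split => j; first exact: (dfun_lsub HS d (dfun_pd j)).
  exact: (dfun_rsub HS d (dfun_coord HS j)).
have [||||||psi [eps [K [eps0 nd bd H]]]] := @desingularize R S HS (d + d)
  (fun z => energy z - V) (fun z => \sum_i denergy i z ^+ 2) denergy B.
- by apply: dfunB => //; exact: dfun_cst.
- exact: dN.
- by move=> z; apply: cvgB (energy_continuous (x:=z)) _; exact: cvg_cst.
- apply: (@continuous_sum R) => i; apply: continuous_sqr; exact: denergy_continuous.
- by [].
- move=> z e e0; have [r r0 Hr] := energy_first_order z e0; exists r => // z' /Hr.
  by rewrite (_ : energy z' - V - (energy z - V) = energy z' - energy z)//; ring.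
exists psi, eps, K; split => // z e zB zV e0; have [dl dl0 Hdl] := H z e zB zV e0.
exists dl => // z' z'B z'V z'z zz'; have := Hdl z' z'B z'V.
rewrite lerD2r (_ : energy z - V - (energy z' - V) = energy z - energy z'); first exact.
by ring.
Qed.

End DefinableEnergy.

Lemma dfun_of_definable (R : realType) (S : forall n : nat, set (set 'rV[R]_n)) d
    (f : 'rV[R]_d -> R) : o_minimal_structure S ->
  S (d + 1)%N [set v | exists u, v = row_mx u (const_mx (f u) : 'rV[R]_1)] -> dfun S f.
Proof.
move=> HS; apply: S_eq => v; split => [[u ->]|vE].
  by rewrite row_mxKl row_mxEr mxE.
exists (lsubmx v); rewrite -{1}(hsubmxK v); congr row_mx.
by apply/rowP => j; rewrite !mxE ord1.
Qed.

(** * Global solutions of Lipschitz equations *)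

Section Picard.
Variable R : realType.

(** For a = 2 K this is the contraction estimate in the norm weighted by exp (- 2 K |t|): a
    derivative of size K exp (2 K |t|) integrates to at most half of exp (2 K |t|). Time intervals
    of any length are thus handled at once. *)
Lemma exp_compare (D D' : R -> R) (a c T : R) : 0 <= a -> 0 <= c -> D 0 = 0 ->
  (forall t : R, is_derive t 1 D (D' t)) ->
  (forall t, `|t| <= T -> `|D' t| <= c * a * expR (a * `|t|)) ->
  forall t, `|t| <= T -> `|D t| <= c * expR (a * `|t|).
Proof.
move=> a0 c0.
have pos (B B' : R -> R) t : B 0 = 0 -> (forall t : R, is_derive t 1 B (B' t)) ->
    0 <= t -> (forall s, 0 <= s <= t -> B' s <= c * a * expR (a * s)) -> B t <= c * expR (a * t).
  move=> B0 dB t0 HB.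
  have dE (s : R) : is_derive s 1 (fun s => c * expR (a * s)) (c * a * expR (a * s)).
    apply: is_derive_eq; rewrite /GRing.scale /=; ring.
  have := @derive_le R B (fun s => c * expR (a * s)) B' (fun s => c * a * expR (a * s)) 0 t t0
    (fun s _ => dB s) (fun s _ => dE s).
  have cB : continuous B by move=> s; apply: is_derive_continuous; exact: dB.
  have cE : continuous (fun s => c * expR (a * s)).
    by move=> s; apply: is_derive_continuous; exact: dE.
  move=> /(_ cB cE) H; have {H} : B t - B 0 <= c * expR (a * t) - c * expR (a * 0).
    by apply: H => s /andP[s0 st]; apply: HB; rewrite !ltW.
  rewrite B0 subr0 mulr0 expR0; lra.
have posN (B B' : R -> R) t : B 0 = 0 -> (forall t : R, is_derive t 1 B (B' t)) ->
    0 <= t -> (forall s, 0 <= s <= t -> `|B' s| <= c * a * expR (a * s)) ->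
    `|B t| <= c * expR (a * t).
  move=> B0 dB t0 HB; rewrite ler_norml lerNl; apply/andP; split; last first.
    by apply: (pos B B') => // s /HB; exact: le_trans (ler_norm _).
  apply: (pos (fun s => - B s) (fun s => - B' s)) => //; first by rewrite B0 oppr0.
  by move=> s /HB; apply: le_trans; rewrite -normrN ler_norm.
move=> D0 dD HD t tT; have [t0|/ltW t0] := leP 0 t.
  rewrite [X in expR (a * X)]ger0_norm//; apply: (posN D D') => // s /andP[s0 st].
  rewrite -[X in expR (a * X)]ger0_norm//; apply: HD; rewrite ger0_norm//.
  by apply: le_trans st (le_trans (ler_norm _) tT).
rewrite -[in leLHS](opprK t) (ler0_norm t0).
apply: (posN (fun s => D (- s)) (fun s => - D' (- s)) (- t)); rewrite ?oppr0 ?oppr_ge0//.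
  move=> s; have ds := dD (- s).
  by apply: is_derive_eq; rewrite /GRing.scale /=; ring.
move=> s /andP[s0 st]; rewrite normrN -[X in expR (a * X)]ger0_norm// -[X in expR (a * X)]normrN.
apply: HD; rewrite normrN ger0_norm//; apply: le_trans st _.
by apply: le_trans tT; rewrite -normrN ler_norm.
Qed.

(** The intervals of radius 2 q 2^-k about u k are nested, and the supremum of their left ends lies
    in all of them. *)
Lemma geometric_limit (u : nat -> R) (q : R) :
  (forall k, `|u k.+1 - u k| <= q * 2^-1 ^+ k) ->
  forall k, `|limn u - u k| <= 2 * q * 2^-1 ^+ k.
Proof.
move=> H.
have q0 : 0 <= q by have := H 0%N; rewrite expr0 mulr1; apply: le_trans.
pose a k := u k - 2 * q * 2^-1 ^+ k; pose b k := u k + 2 * q * 2^-1 ^+ k.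
have p0 k : 0 <= (2^-1 : R) ^+ k by rewrite exprn_ge0.
have step k : a k <= a k.+1 /\ b k.+1 <= b k.
  have := H k; rewrite ler_norml /a /b exprS => /andP[h1 h2]; split; lra.
have amono : {homo a : k m / (k <= m)%N >-> k <= m}.
  by apply: homo_leq => [x|y x z|k]; [exact: lexx|exact: le_trans|exact: (step k).1].
have bmono : {homo b : k m / (k <= m)%N >-> m <= k}.
  by apply: (@homo_leq _ _ (fun x y => y <= x)) => [x|y x z|k];
   [exact: lexx|move=> h1 h2; exact: le_trans h2 h1|exact: (step k).2].
have ab k m : a k <= b m.
  apply: le_trans (amono _ _ (leq_maxl k m)) _; apply: le_trans (bmono _ _ (leq_maxr k m)).
  rewrite /a /b; have := mulr_ge0 q0 (p0 (maxn k m)); lra.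
have hs : has_sup (range a) by split; [exists (a 0%N), 0%N|exists (b 0%N) => _ [k _ <-]].
pose l := sup (range a).
have al k : a k <= l by apply: sup_upper_bound => //; exists k.
have lb k : l <= b k by apply: sup_le_ub => [|_ [m _ <-]//]; exists (a 0%N), 0%N.
have dist k : `|l - u k| <= 2 * q * 2^-1 ^+ k.
  by have := al k; have := lb k; rewrite /a /b ler_norml => h1 h2; apply/andP; split; lra.
have cvl : u @ \oo --> l.
  have c0 : (2 * q * 2^-1 ^+ k) @[k --> \oo] --> (0 : R).
    rewrite -(mulr0 (2 * q)); apply: cvgMl_tmp; apply: cvg_expr.
    by rewrite ger0_norm// invf_lt1// ltr1n.
  apply/cvgrPdist_le => e e0; have /cvgrPdist_le/(_ e e0) := c0.
  apply: filterS => k; rewrite sub0r normrN => h; apply: le_trans (dist k) _.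
  exact: le_trans (ler_norm _) h.
by rewrite (cvg_lim _ cvl).
Qed.

Lemma le0_geometric (x q : R) : (forall k, x <= q * 2^-1 ^+ k) -> x <= 0.
Proof.
move=> H.
have c0 : (q * 2^-1 ^+ k) @[k --> \oo] --> (0 : R).
  rewrite -(mulr0 q); apply: cvgMl_tmp; apply: cvg_expr.
  by rewrite ger0_norm// invf_lt1// ltr1n.
rewrite -(cvg_lim _ c0)//; apply: limr_ge; first by apply/cvg_ex; exists 0.
by apply: nearW => k; exact: H.
Qed.

Variables (n : nat) (F : R -> 'rV[R]_n -> 'rV[R]_n) (y0 : 'rV[R]_n).
(** Continuity is stated along curves, as the iterates use it; the Lipschitz constant in [LF] may
    grow with the time interval. *)
Hypothesis cF : forall y : R -> 'rV[R]_n, continuous y -> continuous (fun t => F t (y t)).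
Hypothesis LF : forall T : R, exists2 K : R, 0 <= K &
  forall t y y', `|t| <= T -> `|F t y - F t y'| <= K * `|y - y'|.

Let Pic (y : R -> 'rV[R]_n) (t : R) : 'rV[R]_n :=
  \row_i (y0 0 i + primitive (fun s => F s (y s) 0 i) t).

Let yk k := iter k Pic (fun=> y0).

Let cFi (y : R -> 'rV[R]_n) i : continuous y -> continuous (fun t => F t (y t) 0 i).
Proof. by move=> cy; apply: continuous_coord; exact: cF. Qed.

Let is_derive_Pic y (t : R) i : continuous y ->
  is_derive t 1 (fun s => Pic y s 0 i) (F t (y t) 0 i).
Proof.
move=> cy; have := is_derive_primitive t (cFi (i := i) cy).
rewrite (_ : (fun s => Pic y s 0 i) = fun s => y0 0 i + primitive (fun s => F s (y s) 0 i) s).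
  by move=> h; rewrite -[F t _ 0 i]add0r; apply: is_deriveD.
by apply/funext => s; rewrite mxE.
Qed.

Let cPic y : continuous y -> continuous (Pic y).
Proof.
move=> cy; apply: continuous_row => i t; apply: is_derive_continuous.
exact: is_derive_Pic.
Qed.

Let cyk k : continuous (yk k).
Proof. by elim: k => [|k IH]; [move=> t; exact: cvg_cst|exact: cPic]. Qed.

Let Pic0 y : continuous y -> Pic y 0 = y0.
Proof. by move=> cy; apply/rowP => i; rewrite mxE primitive0 ?addr0//; exact: cFi. Qed.

Let Pic_compare (K T c : R) y y' : 0 <= K ->
  (forall t y y', `|t| <= T -> `|F t y - F t y'| <= K * `|y - y'|) ->
  continuous y -> continuous y' -> 0 <= c ->
  (forall t, `|t| <= T -> `|y t - y' t| <= c * expR (2 * K * `|t|)) ->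
  forall t, `|t| <= T -> `|Pic y t - Pic y' t| <= c / 2 * expR (2 * K * `|t|).
Proof.
move=> K0 HK cy cy' c0 H t tT.
apply: norm_le_coord => [|i]; first by rewrite mulr_ge0 ?divr_ge0// expR_ge0.
rewrite !mxE.
pose D s := primitive (fun s => F s (y s) 0 i) s - primitive (fun s => F s (y' s) 0 i) s.
rewrite (_ : _ - _ = D t); last by rewrite /D; ring.
apply: (@exp_compare D (fun s => F s (y s) 0 i - F s (y' s) 0 i) (2 * K) (c / 2) T) => //.
- by rewrite mulr_ge0.
- by rewrite divr_ge0.
- by rewrite /D !primitive0 ?subrr//; exact: cFi.
- by move=> s; apply: is_deriveB; apply: is_derive_primitive; exact: cFi.
move=> s sT; have := coord_le_norm (F s (y s) - F s (y' s)) i; rewrite !mxE => h.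
apply: le_trans h _; apply: le_trans (HK _ _ _ sT) _.
have := ler_wpM2l K0 (H s sT); move=> h; apply: le_trans h _.
by rewrite le_eqVlt; apply/orP; left; apply/eqP; field.
Qed.

Let step_bound T : exists2 q : R, 0 <= q &
  forall k t, `|t| <= T -> `|yk k.+1 t - yk k t| <= q * 2^-1 ^+ k.
Proof.
have [K K0 HK] := LF T.
have [c c0 Hc] : exists2 c : R, 0 <= c & forall t, `|t| <= T -> `|yk 1 t - yk 0 t| <= c.
  have cn : continuous (fun t => `|yk 1 t - yk 0 t|).
    move=> t; apply: (@continuous_comp _ _ _ (fun t => yk 1 t - yk 0 t) Num.norm).
      by apply: cvgB; exact: cyk.
    exact: norm_continuous.
  have [T0|T0] := leP (- T) T.
    have [x _ Hx] := EVT_max T0 (continuous_subspaceT cn).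
    exists `|yk 1 x - yk 0 x| => // t; rewrite ler_norml => tT; apply: Hx.
    by rewrite in_itv.
  exists 0 => // t tT; exfalso; have := le_trans (normr_ge0 _) tT; lra.
exists (c * expR (2 * K * T)); first by rewrite mulr_ge0// expR_ge0.
have key k t : `|t| <= T -> `|yk k.+1 t - yk k t| <= c * 2^-1 ^+ k * expR (2 * K * `|t|).
  elim: k t => [|k IH] t tT.
    rewrite expr0 mulr1; apply: le_trans (Hc _ tT) _; rewrite ler_peMr//.
    by rewrite -expR0 ler_expR !mulr_ge0.
  rewrite exprSr mulrA; apply: Pic_compare (HK) (@cyk _) (@cyk _) _ IH _ tT => //.
  by rewrite mulr_ge0// exprn_ge0.
move=> k t tT; apply: le_trans (key k t tT) _; rewrite mulrAC.
rewrite ler_wpM2r ?exprn_ge0// ler_wpM2l// ler_expR ler_wpM2l//.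
by rewrite mulr_ge0.
Qed.

Theorem picard : exists y : R -> 'rV[R]_n, [/\ y 0 = y0, continuous y &
  forall (t : R) i, is_derive t 1 (fun s => y s 0 i) (F t (y t) 0 i)].
Proof.
pose y (t : R) : 'rV[R]_n := \row_i limn (fun k => yk k t 0 i).
have ybound T : exists2 q : R, 0 <= q & forall k t, `|t| <= T -> `|y t - yk k t| <= q * 2^-1 ^+ k.
  have [q q0 Hq] := step_bound T; exists (2 * q) => [|k t tT]; first by rewrite mulr_ge0.
  apply: norm_le_coord => [|i]; first by rewrite !mulr_ge0// exprn_ge0.
  rewrite !mxE; apply: (@geometric_limit (fun k => yk k t 0 i)) => j.
  apply: le_trans (Hq j t tT).
  by have := coord_le_norm (yk j.+1 t - yk j t) i; rewrite !mxE.
have cy : continuous y.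
  move=> t; apply/continuous_distP => e e0.
  have [q q0 Hq] := ybound (`|t| + 1).
  have [k Hk] : exists k, q * 2^-1 ^+ k < e / 3.
    apply: contrapT => /forallNP H.
    suff : e / 3 <= 0 by lra.
    by apply: (@le0_geometric _ q) => k; rewrite leNgt; apply/negP; exact: H.
  have [|dl dl0 Hdl] := (continuous_distP (yk k) t).1 (@cyk k t) (e / 3); first by lra.
  exists (Num.min 1 dl); first by rewrite lt_min ltr01.
  move=> s; rewrite lt_min => /andP[s1 sdl].
  have sT : `|s| <= `|t| + 1.
    by rewrite -(subrK t s) (addrC `|t|) (le_trans (ler_normD _ _))// lerD2r ltW.
  have tT : `|t| <= `|t| + 1 by rewrite lerDl.
  have -> : y s - y t = (y s - yk k s) + (yk k s - yk k t) - (y t - yk k t).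
    by apply/rowP => j; rewrite !mxE; ring.
  apply: le_lt_trans (ler_normB _ _) _; have := ler_normD (y s - yk k s) (yk k s - yk k t).
  have := Hq k s sT; have := Hq k t tT; have := Hdl _ sdl; lra.
have fix_ : y = Pic y.
  apply/funext => t; have [q q0 Hq] := ybound `|t|; have [K K0 HK] := LF `|t|.
  apply/eqP; rewrite -subr_eq0 -normr_le0.
  (* Both y and [Pic y] are within a multiple of 2^-k of the iterate of index k + 1. *)
  apply: (@le0_geometric _ (q + q * expR (2 * K * `|t|))) => k.
  have E : y t - Pic y t = (y t - yk k.+1 t) - (Pic y t - Pic (yk k) t).
    by apply/rowP => j; rewrite !mxE; ring.
  rewrite E; apply: le_trans (ler_normB _ _) _; rewrite mulrDl; apply: lerD.
    apply: le_trans (Hq k.+1 t (lexx _)) _; rewrite ler_wpM2l// exprS.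
    by rewrite ler_piMl ?exprn_ge0// invf_le1// ler1n.
  have qk : 0 <= q * 2^-1 ^+ k by rewrite mulr_ge0// exprn_ge0.
  have H s : `|s| <= `|t| -> `|y s - yk k s| <= q * 2^-1 ^+ k * expR (2 * K * `|s|).
    move=> st; apply: le_trans (Hq k s st) _; rewrite ler_peMr//.
    by rewrite -expR0 ler_expR !mulr_ge0.
  have := Pic_compare K0 HK cy (@cyk k) qk H (lexx _).
  move=> h; apply: le_trans h _; rewrite [leRHS]mulrAC ler_wpM2r ?expR_ge0//; lra.
exists y; split => //; first by rewrite fix_ Pic0.
by move=> t i; rewrite {1}fix_; exact: is_derive_Pic.
Qed.

End Picard.

(** * The Lyapunov function *)

Section Lyapunov.
Variables (R : realType) (d : nat) (f : 'rV[R]_d -> R) (gamma : R -> R) (c C beta : R).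
Hypothesis Cf : C1 f.
Hypotheses (c0 : 0 < c) (cC : c <= C) (b0 : 0 < beta) (bC : beta < 2 * c / C ^+ 2).
Variables (x v a : R -> 'rV[R]_d).
Hypothesis dx : forall (t : R) i, is_derive t 1 (fun s => x s 0 i) (v t 0 i).
Hypothesis dv : forall (t : R) i, is_derive t 1 (fun s => v s 0 i) (a t 0 i).

(** With g the gradient at the shifted point and x'' = - gamma x' - g, the derivative of the energy
    is - (beta / 2) |g + gamma x'|^2 - (beta / 2) |g|^2 - gamma (1 - beta gamma / 2) |x'|^2, and
    gamma (1 - beta gamma / 2) >= c (1 - beta C / 2). *)
Definition decay_rate : R := Num.min (beta / 2) (c * (1 - beta * C / 2)).

Lemma betaC_lt2 : beta * C < 2.
Proof.
have C0 : 0 < C by exact: lt_le_trans cC.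
have : beta * C ^+ 2 < 2 * c by rewrite -ltr_pdivlMr// exprn_gt0.
by move=> h; rewrite -(ltr_pM2r C0) -mulrA -expr2; apply: lt_le_trans h _; rewrite ler_pM2l.
Qed.

Lemma decay_rate_gt0 : 0 < decay_rate.
Proof.
by rewrite lt_min divr_gt0//= mulr_gt0//; have := betaC_lt2; lra.
Qed.

Definition shifted (t : R) : 'rV[R]_d := x t + beta *: v t.
Definition phase (t : R) : 'rV[R]_(d + d) := row_mx (shifted t) (v t).
Definition sqnorm_denergy (t : R) : R := \sum_i denergy f i (phase t) ^+ 2.

Lemma sqnorm_denergyE t : sqnorm_denergy t = \sum_i pd f i (shifted t) ^+ 2 + \sum_i v t 0 i ^+ 2.
Proof. by rewrite /sqnorm_denergy (sum_denergy f (fun _ y => y ^+ 2)) row_mxKl row_mxKr. Qed.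

Lemma energy_phaseE t : energy f (phase t) = f (shifted t) + (\sum_i v t 0 i ^+ 2) / 2.
Proof. by rewrite /energy row_mxKl row_mxKr. Qed.

Lemma is_derive_shifted (t : R) i :
  is_derive t 1 (fun s => shifted s 0 i) ((v t + beta *: a t) 0 i).
Proof.
rewrite (_ : (fun s => _) = fun s => x s 0 i + beta * v s 0 i); last first.
  by apply/funext => s; rewrite !mxE.
have := dx t i; have := dv t i => h1 h2.
by apply: is_derive_eq; rewrite !mxE.
Qed.

Lemma is_derive_energy (t : R) : is_derive t 1 (fun s => energy f (phase s))
  (\sum_i (pd f i (shifted t) * (v t 0 i + beta * a t 0 i) + v t 0 i * a t 0 i)).
Proof.
rewrite (_ : (fun s => _) = fun s => f (shifted s) + \sum_i (v s 0 i ^+ 2 / 2)); last first.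
  by apply/funext => s; rewrite energy_phaseE mulr_suml.
rewrite big_split /=; apply: is_deriveD.
  apply: (is_derive_eq (@is_derive_chain R d f shifted _ t Cf (is_derive_shifted t))).
  by apply: eq_bigr => i _; rewrite !mxE.
rewrite (_ : (fun s => _) = \sum_i (fun s => v s 0 i ^+ 2 / 2)); last first.
  by apply/funext => s; rewrite fct_sumE.
apply: is_derive_sum => i; have h := dv t i.
by apply: is_derive_eq; rewrite /GRing.scale /=; field.
Qed.

Lemma energy_decay_term (g w y k : R) : c <= k <= C -> y = - k * w - g ->
  g * (w + beta * y) + w * y <= - decay_rate * (g ^+ 2 + w ^+ 2).
Proof.
move=> /andP[ck kC] ->.
have r1 : decay_rate <= beta / 2 by rewrite ge_min lexx.
have r2 : decay_rate <= c * (1 - beta * C / 2) by rewrite ge_min lexx orbT.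
have r3 : c * (1 - beta * C / 2) <= k * (1 - beta * k / 2).
  apply: ler_pM => //; first exact: ltW.
    by have := betaC_lt2; lra.
  by have := ler_wpM2l (ltW b0) kC; lra.
have g2 : 0 <= g ^+ 2 by exact: sqr_ge0.
have w2 : 0 <= w ^+ 2 by exact: sqr_ge0.
have h1 := ler_wpM2r g2 r1; have h2 := ler_wpM2r w2 (le_trans r2 r3).
have h3 : 0 <= beta / 2 * (g + k * w) ^+ 2 by rewrite mulr_ge0 ?sqr_ge0// divr_ge0// ltW.
nra.
Qed.

Lemma energy_decay (t : R) : c <= gamma t <= C ->
  a t + gamma t *: v t + grad f (shifted t) = 0 ->
  \sum_i (pd f i (shifted t) * (v t 0 i + beta * a t 0 i) + v t 0 i * a t 0 i) <=
  - decay_rate * sqnorm_denergy t.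
Proof.
move=> gt E; rewrite sqnorm_denergyE mulrDr !mulr_sumr -big_split /=; apply: ler_sum => i _.
rewrite -mulrDr; apply: energy_decay_term gt _.
have := congr1 (fun w : 'rV[R]_d => w 0 i) E; rewrite !mxE; lra.
Qed.

Lemma v_continuous : continuous v.
Proof. by apply: continuous_row => i t; apply: is_derive_continuous; exact: dv. Qed.

Lemma x_continuous : continuous x.
Proof. by apply: continuous_row => i t; apply: is_derive_continuous; exact: dx. Qed.

Lemma shifted_continuous : continuous shifted.
Proof.
by apply: continuous_row => i t; apply: is_derive_continuous; exact: is_derive_shifted.
Qed.

Lemma energy_phase_continuous : continuous (fun t => energy f (phase t)).
Proof. by move=> t; apply: is_derive_continuous; exact: is_derive_energy. Qed.

(** From m + |v|^2 / 2 <= energy at t <= energy at 0. *)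
Definition vbound (m : R) : R := Num.sqrt (2 * (energy f (phase 0) - m)).

Lemma sqnorm_denergy_ge0 t : 0 <= sqnorm_denergy t.
Proof. by apply: sumr_ge0 => i _; exact: sqr_ge0. Qed.

Section UpTo.
Variables (m T : R).
Hypothesis fm : forall u, m <= f u.
Hypothesis gb : forall t, 0 <= t -> c <= gamma t <= C.
Hypothesis ode : forall t, 0 < t < T -> a t + gamma t *: v t + grad f (shifted t) = 0.

(** The equation is assumed on (0, T) only, so that these bounds apply to the truncated system
    before the truncation is known to be inactive. *)
Lemma energy_nonincr s t : 0 <= s -> s <= t -> t <= T -> energy f (phase t) <= energy f (phase s).
Proof.
move=> s0 st tT; apply: (derive_nonincr st (fun r _ => is_derive_energy r) energy_phase_continuous).
move=> r /andP[sr rt]; have r0 : 0 < r by exact: le_lt_trans sr.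
apply: le_trans (energy_decay (gb (ltW r0)) (ode _)) _.
  by rewrite r0 (lt_le_trans rt tT).
by rewrite mulNr oppr_le0 mulr_ge0 ?sqnorm_denergy_ge0// ltW// decay_rate_gt0.
Qed.

Lemma velocity_bound t : 0 <= t -> t <= T -> enorm (v t) <= vbound m.
Proof.
move=> t0 tT; apply: ler_wsqrtr.
have := energy_nonincr (lexx 0) t0 tT; rewrite (energy_phaseE t); have := fm (shifted t); lra.
Qed.

Lemma position_bound t : 0 <= t -> t <= T -> `|x t| <= `|x 0| + t * vbound m.
Proof.
move=> t0 tT.
have vb0 : 0 <= vbound m by exact: sqrtr_ge0.
apply: norm_le_coord => [|i]; first by rewrite addr_ge0// mulr_ge0.
have dM (s : R) : is_derive s 1 (fun s => s * vbound m) (vbound m).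
  by apply: is_derive_eq; rewrite /GRing.scale /= mulr0 add0r mulr1.
have cM : continuous (fun s : R => s * vbound m).
  by move=> s; apply: is_derive_continuous; exact: dM.
have vb s : 0 < s < t -> `|v s 0 i| <= vbound m.
  move=> /andP[s0 st]; apply: le_trans (coord_le_enorm _ _) (velocity_bound (ltW s0) _).
  exact: le_trans (ltW st) tT.
have cx : continuous (fun s => x s 0 i) by apply: continuous_coord; exact: x_continuous.
have := derive_le t0 (fun s _ => dx s i) (fun s _ => dM s) cx cM
  (fun s st => le_trans (ler_norm _) (vb s st)).
have dNx (s : R) : is_derive s 1 (fun s => - x s 0 i) (- v s 0 i).
  by apply: is_deriveN; exact: dx.
have cNx : continuous (fun s => - x s 0 i).
  by move=> s; apply: is_derive_continuous; exact: dNx.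
have := derive_le t0 (fun s _ => dNx s) (fun s _ => dM s) cNx cM.
have h s : 0 < s < t -> - v s 0 i <= vbound m.
  by move=> /vb; apply: le_trans; rewrite -normrN ler_norm.
move=> /(_ h); have := coord_le_norm (x 0) i; rewrite mul0r !ler_norml => /andP[h1 h2] h3 h4.
by apply/andP; split; lra.
Qed.

Lemma shifted_bound t : 0 <= t -> t <= T -> `|shifted t| <= `|x 0| + (t + beta) * vbound m.
Proof.
move=> t0 tT; apply: le_trans (ler_normD _ _) _; rewrite mulrDl addrA; apply: lerD.
  exact: position_bound.
rewrite normrZ gtr0_norm// ler_pM2l//; apply: le_trans (norm_le_enorm _) _.
exact: velocity_bound.
Qed.

End UpTo.
End Lyapunov.

(** * Existence *)

Section Existence.
Variables (R : realType) (d : nat).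

Definition clamp (b : R) (u : 'rV[R]_d) : 'rV[R]_d :=
  \row_i Num.max (- b) (Num.min b (u 0 i)).

Lemma clamp_id b u : `|u| <= b -> clamp b u = u.
Proof.
move=> ub; apply/rowP => i; rewrite mxE.
have := le_trans (coord_le_norm u i) ub; rewrite ler_norml => /andP[h1 h2].
by rewrite (min_idPr h2) (max_idPr h1).
Qed.

Lemma norm_clamp b u : 0 <= b -> `|clamp b u| <= b.
Proof.
move=> b0; apply: norm_le_coord => // i; rewrite mxE ler_norml.
by rewrite le_max lexx ge_max ge_min lexx /= andbT; lra.
Qed.

Lemma max_lipschitz (b p q : R) : `|Num.max b p - Num.max b q| <= `|p - q|.
Proof.
rewrite !maxEle; case: (leP b p) => ?; case: (leP b q) => ?; rewrite ler_norml;
  by case: (ger0P (p - q)) => ?; apply/andP; split; lra.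
Qed.

Lemma min_lipschitz (b p q : R) : `|Num.min b p - Num.min b q| <= `|p - q|.
Proof.
rewrite !minEle; case: (leP b p) => ?; case: (leP b q) => ?; rewrite ler_norml;
  by case: (ger0P (p - q)) => ?; apply/andP; split; lra.
Qed.

Lemma clamp_lipschitz b u u' : `|clamp b u - clamp b u'| <= `|u - u'|.
Proof.
apply: norm_le_coord => // i; rewrite !mxE.
have := coord_le_norm (u - u') i; rewrite !mxE; apply: le_trans.
exact: le_trans (max_lipschitz _ _ _) (min_lipschitz _ _ _).
Qed.

Lemma clamp_continuous (B : R -> R) (u : R -> 'rV[R]_d) :
  continuous B -> continuous u -> continuous (fun t => clamp (B t) (u t)).
Proof.
move=> cB cu; apply: continuous_row => i.
rewrite (_ : (fun s => _) = (\- B) \max (B \min (fun s => u s 0 i))); last first.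
  by apply/funext => s; rewrite mxE.
move=> t; apply: continuous_max; first by apply: continuousN; exact: cB.
apply: continuous_min; first exact: cB.
by apply: cvg_coord; exact: cu.
Qed.

(** The even extension of gamma is continuous and lets the Picard scheme run on the whole line. *)
Lemma continuous_gamma_norm (gamma : R -> R) :
  {within @Rplus R, continuous gamma} -> continuous (fun t : R => gamma `|t|).
Proof.
move=> /subspace_continuousP H t.
have H1 := H `|t| (normr_ge0 t).
apply: cvg_comp H1 => A /= [e /= e0 He].
have [dl /= dl0 Hdl] : \forall s \near t, ball `|t| e `|s|.
  by have := @norm_continuous R R^o t _ (nbhsx_ballx `|t| e e0).
by exists dl => //= s st; apply: He; [exact: Hdl|rewrite /Rplus /=].
Qed.

Lemma norm_row_mx p q (u : 'rV[R]_p) (w : 'rV[R]_q) (b : R) :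
  `|u| <= b -> `|w| <= b -> `|row_mx u w| <= b.
Proof.
move=> ub wb; apply: norm_le_coord => [|i]; first exact: le_trans ub.
rewrite mxE; case: fintype.split => j; [apply: le_trans ub|apply: le_trans wb];
  exact: coord_le_norm.
Qed.

Lemma norm_lsubmx p q (z : 'rV[R]_(p + q)) : `|lsubmx z| <= `|z|.
Proof. by apply: norm_le_coord => // i; rewrite mxE coord_le_norm. Qed.

Lemma norm_rsubmx p q (z : 'rV[R]_(p + q)) : `|rsubmx z| <= `|z|.
Proof. by apply: norm_le_coord => // i; rewrite mxE coord_le_norm. Qed.

Variables (f : 'rV[R]_d -> R) (gamma : R -> R) (c C beta m : R) (x0 v0 : 'rV[R]_d).
Hypothesis Cf2 : C2 f.
Hypothesis fm : forall u, m <= f u.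
Hypothesis cg : {within @Rplus R, continuous gamma}.
Hypotheses (c0 : 0 < c) (cC : c <= C).
Hypothesis gb : forall t, 0 <= t -> c <= gamma t <= C.
Hypotheses (b0 : 0 < beta) (bC : beta < 2 * c / C ^+ 2).

Let Cf : C1 f := C2_C1 Cf2.

Let vm : R := Num.sqrt (2 * (energy f (row_mx (x0 + beta *: v0) v0) - m)).

(** The bound of [shifted_bound], with initial data in place of the solution still to be found, plus
    a margin 1 for the exit-time argument. *)
Let B (t : R) : R := `|x0| + (`|t| + beta) * vm + 1.

Let F (t : R) (y : 'rV[R]_(d + d)) : 'rV[R]_(d + d) :=
  row_mx (rsubmx y)
    (- (gamma `|t| *: rsubmx y) - grad f (clamp (B t) (lsubmx y + beta *: rsubmx y))).

Let vm0 : 0 <= vm. Proof. exact: sqrtr_ge0. Qed.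

Let cB : continuous B.
Proof.
move=> t; apply: cvgD; last exact: cvg_cst.
apply: cvgD; first exact: cvg_cst.
apply: cvgMr_tmp; apply: cvgD; last exact: cvg_cst.
exact: (@norm_continuous R R^o).
Qed.

Let B_gt0 t : 0 < B t.
Proof. by rewrite ltr_wpDl// addr_ge0// mulr_ge0// addr_ge0// ltW. Qed.

Let cshift (y : R -> 'rV[R]_(d + d)) : continuous y ->
  continuous (fun t => lsubmx (y t) + beta *: rsubmx (y t)).
Proof.
move=> cy t; apply: cvgD; first exact: (continuous_funcomp cy (@lsubmx_continuous R d d)).
by apply: cvgZl_tmp; exact: (continuous_funcomp cy (@rsubmx_continuous R d d)).
Qed.

Let crs (y : R -> 'rV[R]_(d + d)) : continuous y -> continuous (fun t => rsubmx (y t)).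
Proof. by move=> cy; exact: (continuous_funcomp cy (@rsubmx_continuous R d d)). Qed.

Let cF2 (y : R -> 'rV[R]_(d + d)) : continuous y -> continuous (fun t =>
  - (gamma `|t| *: rsubmx (y t)) - grad f (clamp (B t) (lsubmx (y t) + beta *: rsubmx (y t)))).
Proof.
move=> cy t; apply: cvgB.
  apply: cvgN; apply: cvgZ; first exact: continuous_gamma_norm.
  exact: crs.
exact: (continuous_funcomp (clamp_continuous cB (cshift cy)) (grad_continuous Cf)).
Qed.

Let cF (y : R -> 'rV[R]_(d + d)) : continuous y -> continuous (fun t => F t (y t)).
Proof.
move=> cy; apply: continuous_row => i.
rewrite -(splitK i); case: (fintype.split i) => j /=.
  rewrite (_ : (fun t => _) = fun t => rsubmx (y t) 0 j).
    by apply: continuous_coord; exact: crs.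
  by apply/funext => t; rewrite row_mxEl.
have h := @continuous_coord R _ _ _ j (cF2 cy).
apply: (eq_ind _ (fun g : R -> R => continuous g) h).
by apply/funext => t; rewrite row_mxEr.
Qed.

Let LF (T : R) : exists2 K : R, 0 <= K &
  forall t y y', `|t| <= T -> `|F t y - F t y'| <= K * `|y - y'|.
Proof.
pose BT := `|x0| + (T + beta) * vm + 1.
have [L L0 HL] := grad_lipschitz BT (fun i => C2_C1_pd i Cf2).
have C0 : 0 <= C by apply: ltW; exact: lt_le_trans cC.
have Lb0 : 0 <= L * (1 + beta) by rewrite mulr_ge0// addr_ge0// ltW.
exists (1 + C + L * (1 + beta)) => [|t y y' tT]; first by lra.
set y2 := `|y - y'|; have y20 : 0 <= y2 := normr_ge0 _.
have hr : `|rsubmx y - rsubmx y'| <= y2 by rewrite -linearB; exact: norm_rsubmx.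
have hl : `|lsubmx y - lsubmx y'| <= y2 by rewrite -linearB; exact: norm_lsubmx.
rewrite /F opp_row_mx add_row_mx; apply: norm_row_mx.
  by apply: le_trans hr _; rewrite ler_peMl//; lra.
set u := lsubmx y + _; set u' := lsubmx y' + _.
set g := grad f _; set g' := grad f _; set k := gamma `|t|.
have -> : - (k *: rsubmx y) - g - (- (k *: rsubmx y') - g') =
    - (k *: (rsubmx y - rsubmx y')) - (g - g').
  by rewrite scalerBr !opprD !opprK addrACA.
apply: le_trans (ler_normB _ _) _; rewrite normrN normrZ.
have k0C : `|k| <= C.
  have /andP[k1 k2] := gb (normr_ge0 t); rewrite ger0_norm//.
  by apply: le_trans k1; exact: ltW.
have h1 : `|k| * `|rsubmx y - rsubmx y'| <= C * y2 by apply: ler_pM.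
have BtT : B t <= BT by rewrite lerD2r lerD2l ler_wpM2r// lerD2r.
have h2 : `|g - g'| <= L * `|u - u'|.
  apply: le_trans (HL _ _ _ _) _.
  - by apply: le_trans BtT; apply: norm_clamp; exact: ltW.
  - by apply: le_trans BtT; apply: norm_clamp; exact: ltW.
  - by rewrite ler_wpM2l// clamp_lipschitz.
have h3 : `|u - u'| <= (1 + beta) * y2.
  rewrite (_ : u - u' = (lsubmx y - lsubmx y') + beta *: (rsubmx y - rsubmx y')); last first.
    by rewrite /u /u' scalerBr; apply/rowP => i; rewrite !mxE; ring.
  apply: le_trans (ler_normD _ _) _; rewrite mulrDl mul1r; apply: lerD => //.
  by rewrite normrZ (gtr0_norm b0) ler_pM2l.
have h4 := ler_wpM2l L0 h3.
rewrite !mulrDl mul1r -mulrA; lra.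
Qed.

Theorem ISIHD_existence : exists x : R -> 'rV[R]_d, ISIHD_solution f gamma beta x0 v0 x.
Proof.
have [y [y0E cy dy]] := picard (row_mx x0 v0) cF LF.
pose x t := lsubmx (y t); pose v t := rsubmx (y t).
pose a t := - (gamma `|t| *: v t) - grad f (clamp (B t) (x t + beta *: v t)).
have dx (t : R) i : is_derive t 1 (fun s => x s 0 i) (v t 0 i).
  have := dy t (lshift d i); rewrite /F row_mxEl.
  by rewrite (_ : (fun s => y s 0 _) = fun s => x s 0 i)//; apply/funext => s; rewrite /x mxE.
have dv (t : R) i : is_derive t 1 (fun s => v s 0 i) (a t 0 i).
  have := dy t (rshift d i); rewrite /F row_mxEr.
  by rewrite (_ : (fun s => y s 0 _) = fun s => v s 0 i)//; apply/funext => s; rewrite /v mxE.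
have x0E : x 0 = x0 by rewrite /x y0E row_mxKl.
have v0E : v 0 = v0 by rewrite /v y0E row_mxKr.
have vmE : vbound f beta x v m = vm by rewrite /vbound /phase /shifted x0E v0E.
have ode_in t : 0 < t -> `|shifted beta x v t| <= B t ->
    a t + gamma t *: v t + grad f (shifted beta x v t) = 0.
  move=> t0 ut; rewrite /a -/(shifted beta x v t) clamp_id// gtr0_norm//.
  by apply/rowP => i; rewrite !mxE; ring.
(* Let s be the infimum of the exit times. Before s the truncation is inactive, so [shifted_bound]
   holds at s with the margin 1 to spare, and by continuity there are no exit times just after s. *)
have inside t : 0 <= t -> `|shifted beta x v t| <= B t.
  move=> t0; rewrite leNgt; apply/negP => ut.
  pose A : set R := [set t | 0 <= t /\ B t < `|shifted beta x v t|].
  have hA : has_inf A by split; [exists t|exists 0 => s []].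
  pose s := inf A.
  have s0 : 0 <= s by apply: lb_le_inf => [|r []//]; exists t.
  have below r : 0 <= r -> r < s -> `|shifted beta x v r| <= B r.
    move=> r0 rs; rewrite leNgt; apply/negP => ur.
    have Ar : A r by split.
    by have := @inf_lbound _ _ hA.2 _ Ar; rewrite -/s leNgt rs.
  have us : `|shifted beta x v s| <= B s - 1.
    have := @shifted_bound R d f gamma c C beta Cf c0 cC b0 bC x v a dx dv m s fm gb.
    rewrite x0E vmE /B (ger0_norm s0) addrK; apply => // r /andP[r0 rs].
    by apply: ode_in => //; apply: below => //; exact: ltW.
  have cu : continuous (fun r => B r - `|shifted beta x v r|).
    move=> r; apply: cvgB; first exact: cB.
    apply: (@continuous_comp _ _ _ (shifted beta x v) Num.norm); last exact: norm_continuous.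
    exact: shifted_continuous dx dv _.
  have [|dl dl0 Hdl] := (continuous_distP _ s).1 (cu s) 1; first by [].
  have [r [r0 ur] rs] := inf_adherent dl0 hA; rewrite -/s in rs.
  have sr : s <= r by apply: inf_lbound => //; exact: hA.2.
  have := Hdl r; rewrite ger0_norm ?subr_ge0// ltrBlDl => /(_ rs).
  by rewrite ltr_norml => /andP[+ _]; move: us ur; lra.
have d1 i : derive1 (fun s => x s 0 i) = fun s => v s 0 i.
  by apply/funext => t; exact: is_derive_derive1 (dx t i).
have d2 i : derive1 (fun s => v s 0 i) = fun s => a s 0 i.
  by apply/funext => t; exact: is_derive_derive1 (dv t i).
have velE t : vel x t = v t by apply/rowP => i; rewrite mxE d1.
have accE t : acc x t = a t by apply/rowP => i; rewrite mxE d1 d2.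
exists x; split => //; last by rewrite velE.
(* The truncated equation holds on the whole line and supplies the C^2 regularity there, negative
   times included. *)
- move=> i; rewrite d1 d2; split.
  + by move=> t; have [] := dx t i.
  + by move=> t; have [] := dv t i.
  + by apply: continuous_coord; exact: cF2 cy.
- by move=> t t0; rewrite accE velE; apply: ode_in => //; apply: inside; exact: ltW.
Qed.

End Existence.

(** * Asymptotic lemmas *)

Section Asymptotics.
Variable R : realType.

Lemma primitive_le (h W W' : R -> R) (k m : R) : continuous h -> 0 < k ->
  (forall t : R, is_derive t 1 W (W' t)) -> (forall t, 0 <= t -> m <= W t) ->
  (forall t, 0 < t -> k * h t <= - W' t) ->
  forall t, 0 <= t -> primitive h t <= (W 0 - m) / k.
Proof.
move=> ch k0 dW Wm H t t0.
have dP (s : R) : is_derive s 1 (fun s => k * primitive h s) (k * h s).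
  by have ? := is_derive_primitive s ch; apply: is_derive_eq; rewrite /GRing.scale /=; ring.
have dN (s : R) : is_derive s 1 (fun s => - W s) (- W' s) by apply: is_deriveN.
have cP : continuous (fun s => k * primitive h s).
  by move=> s; apply: is_derive_continuous; exact: dP.
have cN : continuous (fun s => - W s) by move=> s; apply: is_derive_continuous; exact: dN.
have := derive_le t0 (fun s _ => dP s) (fun s _ => dN s) cP cN.
have h1 s : 0 < s < t -> k * h s <= - W' s by move=> /andP[s0 _]; exact: H.
move=> /(_ h1); rewrite primitive0// ler_pdivlMr// mulrC; have := Wm t t0; lra.
Qed.

Lemma Lp_Rplus_bound d (p : nat) (g : R -> 'rV[R]_d) (M : R) : continuous g ->
  (forall t, 0 <= t -> primitive (fun t => enorm (g t) ^+ p) t <= M) -> Lp_Rplus p g.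
Proof.
move=> cg HM; split => [i|].
  apply: measurable_funTS; apply: continuous_measurable_fun.
  exact: continuous_coord.
apply: (@integral_lty R (fun t => enorm (g t) ^+ p) M) => //.
  have := continuous_funcomp (enorm_continuous cg) (@exprn_continuous R p); exact.
by move=> t; rewrite exprn_ge0// enorm_ge0.
Qed.

Lemma barbalat (phi : R -> R) (L M : R) : continuous phi -> (forall t, 0 <= phi t) ->
  (forall s t, 0 <= s -> 0 <= t -> `|phi s - phi t| <= L * `|s - t|) ->
  (forall t, 0 <= t -> primitive phi t <= M) ->
  phi t @[t --> +oo] --> (0 : R).
Proof.
move=> cphi phi0 lip bd.
have [s t s0 st|l Hl] := @nondecr_bounded_cvgy R (primitive phi) M _ bd.
  exact: primitive_nondecr.
have le_l t : 0 <= t -> primitive phi t <= l.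
  move=> t0; apply: (cvgr_to_ge Hl); exists t; split; first exact: num_real.
  by move=> s /ltW ts; exact: primitive_nondecr.
apply/cvgrPdist_le => e e0.
have L0 : 0 <= L by have := lip 1 0 ler01 (lexx 0); rewrite subr0 normr1 mulr1; exact: le_trans.
have L1 : 0 < L + 1 by rewrite ltr_wpDl.
(* Within a time [dl] the function loses at most e / 2, so a value above e makes the primitive grow
   by dl e / 2; the 1 added to L avoids a zero denominator. *)
pose dl := e / (2 * (L + 1)).
have dl0 : 0 < dl by rewrite divr_gt0// mulr_gt0.
have Ldl : L * dl <= e / 2.
  rewrite (_ : e / 2 = (L + 1) * dl); last by rewrite /dl; field; rewrite gt_eqF.
  by rewrite ler_wpM2r ?lerDl// ltW.
have de0 : 0 < dl * (e / 2) by apply: mulr_gt0 => //; lra.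
have /cvgrPdist_lt/(_ _ de0)[A [_ HA]] := Hl.
exists (Num.max A 0); split; first exact: num_real.
move=> t; rewrite gt_max => /andP[At t0].
rewrite sub0r normrN ger0_norm// leNgt; apply/negP => et.
have low s : t < s < t + dl -> e / 2 <= phi s.
  move=> /andP[ts sdl]; have s0 := lt_trans t0 ts.
  have := lip t s (ltW t0) (ltW s0).
  rewrite ler_norml distrC (gtr0_norm (_ : 0 < s - t)) ?subr_gt0//.
  have : L * (s - t) <= L * dl by rewrite ler_wpM2l//; lra.
  by move=> h1 /andP[_ h2]; lra.
have dI (s : R) : is_derive s 1 (fun s => s * (e / 2)) (e / 2).
  by apply: is_derive_eq; rewrite /GRing.scale /= mulr0 add0r mulr1.
have cI : continuous (fun s : R => s * (e / 2)) by move=> s; apply: is_derive_continuous; exact: dI.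
have tdl : t <= t + dl by lra.
have := derive_le tdl (fun s _ => dI s) (fun s _ => is_derive_primitive s cphi) cI
  (primitive_continuous cphi) low.
have := HA _ At; rewrite ltr_norml => /andP[_ h1].
have := le_l (t + dl) (le_trans (ltW t0) tdl).
by rewrite -mulrBl (addrC t) addrK; lra.
Qed.

(** Carrying a bound along with the Lipschitz constant closes the class under squares and under
    composition with C^1 functions. *)
Definition bounded_lipschitz (h : R -> R) := exists2 K : R, 0 <= K &
  (forall t, 0 <= t -> `|h t| <= K) /\
  (forall s t, 0 <= s -> 0 <= t -> `|h s - h t| <= K * `|s - t|).

Lemma bounded_lipschitz_derive (h h' : R -> R) (K1 K2 : R) :
  (forall t : R, is_derive t 1 h (h' t)) ->
  (forall t, 0 <= t -> `|h t| <= K1) -> (forall t, 0 < t -> `|h' t| <= K2) -> bounded_lipschitz h.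
Proof.
move=> dh H1 H2.
have K10 : 0 <= K1 by apply: le_trans (H1 0 (lexx 0)).
have K20 : 0 <= K2 by apply: le_trans (H2 1 ltr01).
exists (K1 + K2); first by rewrite addr_ge0.
have ch : continuous h by move=> t; apply: is_derive_continuous; exact: dh.
have dNh (t : R) : is_derive t 1 (fun t => - h t) (- h' t) by apply: is_deriveN.
have cNh : continuous (fun t => - h t) by move=> t; apply: is_derive_continuous; exact: dNh.
have dI (s : R) : is_derive s 1 (fun s => s * K2) K2.
  by apply: is_derive_eq; rewrite /GRing.scale /= mulr0 add0r mulr1.
have cI : continuous (fun s : R => s * K2) by move=> s; apply: is_derive_continuous; exact: dI.
split => [t t0|s t s0 t0]; first by apply: le_trans (H1 t t0) _; rewrite lerDl.
suff H u w : 0 <= u -> u <= w -> `|h w - h u| <= (K1 + K2) * `|w - u|.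
  by have [st|/ltW ts] := leP s t; [rewrite distrC (distrC s)|]; exact: H.
move=> u0 uw; rewrite (ger0_norm (_ : 0 <= w - u)) ?subr_ge0//.
have b r : u < r < w -> `|h' r| <= K2.
  by move=> /andP[ur _]; apply: H2; exact: le_lt_trans ur.
have b1 r : u < r < w -> h' r <= K2 by move=> /b; exact: le_trans (ler_norm _).
have b2 r : u < r < w -> - h' r <= K2 by move=> /b; apply: le_trans; rewrite -normrN ler_norm.
have := derive_le uw (fun s _ => dh s) (fun s _ => dI s) ch cI b1.
have := derive_le uw (fun s _ => dNh s) (fun s _ => dI s) cNh cI b2.
have : 0 <= K1 * (w - u) by rewrite mulr_ge0// subr_ge0.
by rewrite ler_norml => ? ? ?; apply/andP; split; lra.
Qed.

Lemma bounded_lipschitz_sqr h : bounded_lipschitz h -> bounded_lipschitz (fun t => h t ^+ 2).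
Proof.
move=> [K K0 [H1 H2]]; exists (K ^+ 2 + 2 * K ^+ 2); first by rewrite addr_ge0 ?mulr_ge0 ?exprn_ge0.
have K20 : 0 <= K ^+ 2 by exact: sqr_ge0.
split => [t t0|s t s0 t0].
  rewrite normrX; apply: (@le_trans _ _ (K ^+ 2)); last by lra.
  by rewrite lerXn2r ?nnegrE// H1.
rewrite subr_sqr normrM; apply: (@le_trans _ _ (K * `|s - t| * (2 * K))); last first.
  have := mulr_ge0 K20 (normr_ge0 (s - t)); lra.
apply: ler_pM => //; first exact: H2.
by apply: le_trans (ler_normD _ _) _; have := H1 s s0; have := H1 t t0; lra.
Qed.

Lemma bounded_lipschitz_sum (I : finType) (h : I -> R -> R) :
  (forall i, bounded_lipschitz (h i)) -> bounded_lipschitz (fun t => \sum_i h i t).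
Proof.
move=> /exists2_choice[K K0 H]; exists (\sum_i K i); first exact: sumr_ge0.
split => [t t0|s t s0 t0].
  apply: le_trans (ler_norm_sum _ _ _) _; apply: ler_sum => i _.
  by have [h1 _] := H i; exact: h1.
rewrite -sumrB mulr_suml; apply: le_trans (ler_norm_sum _ _ _) _; apply: ler_sum => i _.
by have [_ h1] := H i; exact: h1.
Qed.

Lemma bounded_lipschitz_comp d (g : 'rV[R]_d -> R) (u : R -> 'rV[R]_d) : C1 g ->
  (forall i, bounded_lipschitz (fun t => u t 0 i)) -> bounded_lipschitz (fun t => g (u t)).
Proof.
move=> Cg /exists2_choice[K K0 H].
pose B := \sum_i K i.
have B0 : 0 <= B by exact: sumr_ge0.
have KB i : K i <= B by rewrite /B (bigD1 i)//= lerDl sumr_ge0.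
have uB t : 0 <= t -> `|u t| <= B.
  move=> t0; apply: norm_le_coord => // i; apply: le_trans (KB i).
  by have [h _] := H i; exact: h.
have [M M0 HM] := bounded_on_ball B (C1_continuous Cg).
have [L L0 HL] := lipschitz_on_ball B Cg.
exists (M + L * B); first by rewrite addr_ge0// mulr_ge0.
split => [t t0|s t s0 t0].
  by apply: le_trans (HM _ (uB t t0)) _; rewrite lerDl mulr_ge0.
apply: le_trans (HL _ _ (uB t t0) (uB s s0)) _.
apply: (@le_trans _ _ (L * (B * `|s - t|))).
  rewrite ler_wpM2l//; apply: norm_le_coord => [|i]; first by rewrite mulr_ge0.
  rewrite !mxE; have [_ h] := H i; apply: le_trans (h s t s0 t0) _.
  by rewrite ler_wpM2r.
by have := mulr_ge0 M0 (normr_ge0 (s - t)); lra.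
Qed.

(** Here h may jump, but only downwards. After tilting by a slope e, let s be the supremum of the
    times up to which the bound holds: h s is at most the earlier values of h, so only l has to be
    continuous there, and the Dini condition leads beyond s. *)
Lemma dini_nonincr (h l : R -> R) (T : R) :
  (forall s t, T <= s -> s <= t -> h t <= h s) -> continuous l ->
  (forall t e, T <= t -> 0 < e -> exists2 dl : R, 0 < dl &
     forall s, t < s < t + dl -> h s + l s - (h t + l t) <= e * (s - t)) ->
  forall t, T <= t -> h t + l t <= h T + l T.
Proof.
move=> hn cl dini b Tb; rewrite -subr_le0.
have key e : 0 < e -> h b + l b <= h T + l T + e * (b - T).
  move=> e0.
  pose A : set R := [set z | T <= z <= b /\
    forall r, T <= r <= z -> h r + l r <= h T + l T + e * (r - T)].
  have AT : A T.
    split; first by rewrite lexx.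
    move=> w /andP[xw wx]; have -> : w = T by apply/eqP; rewrite eq_le xw wx.
    by rewrite subrr mulr0 addr0.
  have hsA : has_sup A by split; [exists T|exists b => z [/andP[]]].
  pose s := sup A.
  have Ts : T <= s by exact: sup_upper_bound.
  have sb : s <= b by apply: sup_le_ub => [|z [/andP[]]//]; exists T.
  have below r : T <= r -> r < s -> h r + l r <= h T + l T + e * (r - T).
    move=> Tr rs; have [|z [_ Az] rz] := @sup_adherent R A (s - r) _ hsA; first by rewrite subr_gt0.
    by apply: Az; rewrite Tr; apply: ltW; move: (rz); rewrite -/s subKr.
  have gs : h s + l s <= h T + l T + e * (s - T).
    move: Ts; rewrite le_eqVlt => /predU1P[<-|Ts]; first by rewrite subrr mulr0 addr0.
    rewrite -subr_le0; apply/ler_addgt0Pr => e1 e10; rewrite add0r.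
    have [dl dl0 Hdl] := (continuous_distP l s).1 (cl s) e1 e10.
    pose r := Num.max T (s - dl / 2).
    have rs : r < s by rewrite gt_max Ts ltrBlDr ltrDl divr_gt0.
    have Tr : T <= r by rewrite le_max lexx.
    have rd : s - dl / 2 <= r by rewrite le_max lexx orbT.
    have : `|l r - l s| < e1 by apply: Hdl; rewrite ltr_norml; apply/andP; split; lra.
    rewrite ltr_norml => /andP[h1 h2]; have := hn _ _ Tr (ltW rs); have := below _ Tr rs.
    have : e * (r - T) <= e * (s - T) by rewrite ler_pM2l//; lra.
    lra.
  have [<-//|ys] := eqVneq s b.
  have {ys} sb' : s < b by rewrite lt_neqAle ys sb.
  have [dl dl0 Hdl] := dini s e Ts e0.
  pose z := Num.min b (s + dl / 2).
  have Az : A z.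
    split; first by rewrite le_min ge_min lexx /= andbT Tb /=; lra.
    move=> w /andP[Tw wz]; have [ws|sw|->//] := ltgtP w s; first exact: below.
    have := Hdl w; rewrite sw /= (_ : w < s + dl); last first.
      by apply: le_lt_trans wz _; rewrite gt_min; apply/orP; right; lra.
    by move=> /(_ isT); lra.
  by have := sup_upper_bound hsA Az; rewrite -/s leNgt lt_min sb' /= ltrDl divr_gt0.
apply/ler_addgt0Pr => e e0; rewrite add0r.
have bT : 0 < b - T + 1 by lra.
have := key (e / (b - T + 1)); rewrite divr_gt0// => /(_ isT).
have : e / (b - T + 1) * (b - T) <= e.
  by rewrite mulrAC ler_pdivrMr// ler_pM2l//; lra.
lra.
Qed.

End Asymptotics.

(** * Behaviour of a trajectory *)

Section Trajectory.
Variables (R : realType) (d : nat) (f : 'rV[R]_d -> R) (gamma : R -> R) (c C beta m : R).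
Hypothesis Cf2 : C2 f.
Hypothesis fm : forall u, m <= f u.
Hypotheses (c0 : 0 < c) (cC : c <= C).
Hypothesis gb : forall t, 0 <= t -> c <= gamma t <= C.
Hypotheses (b0 : 0 < beta) (bC : beta < 2 * c / C ^+ 2).
Variables (x v a : R -> 'rV[R]_d).
Hypothesis dx : forall (t : R) i, is_derive t 1 (fun s => x s 0 i) (v t 0 i).
Hypothesis dv : forall (t : R) i, is_derive t 1 (fun s => v s 0 i) (a t 0 i).
Hypothesis ode : forall t, 0 < t -> a t + gamma t *: v t + grad f (shifted beta x v t) = 0.

Let Cf : C1 f := C2_C1 Cf2.
Let u := shifted beta x v.
Let z := phase beta x v.
Let V t := energy f (z t).
Let n2 := sqnorm_denergy f beta x v.
Let k := decay_rate c C beta.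

Let k_gt0 : 0 < k. Proof. exact: decay_rate_gt0. Qed.
Let cu : continuous u. Proof. exact: shifted_continuous dx dv. Qed.
Let cv : continuous v. Proof. exact: v_continuous dv. Qed.
Let cx : continuous x. Proof. exact: x_continuous dx. Qed.
Let n2_ge0 t : 0 <= n2 t. Proof. exact: sqnorm_denergy_ge0. Qed.

Let V' t := \sum_i (pd f i (u t) * (v t 0 i + beta * a t 0 i) + v t 0 i * a t 0 i).

Let dV (t : R) : is_derive t 1 V (V' t).
Proof. exact: is_derive_energy. Qed.

Let cV : continuous V.
Proof. by move=> t; apply: is_derive_continuous; exact: dV. Qed.

Let V'_le t : 0 < t -> k * n2 t <= - V' t.
Proof.
move=> t0; rewrite lerNr -mulNr; apply: (energy_decay (gamma := gamma)) => //.
  by apply: gb; exact: ltW.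
exact: ode.
Qed.

Let V_nonincr s t : 0 <= s -> s <= t -> V t <= V s.
Proof.
move=> s0 st.
apply: (@energy_nonincr R d f gamma c C beta Cf c0 cC b0 bC x v a dx dv t gb _ s t) => //.
by move=> r /andP[r0 _]; exact: ode.
Qed.

Let V_ge t : m <= V t.
Proof.
rewrite /V energy_phaseE; apply: ler_wpDr (fm _).
by rewrite divr_ge0// sumr_ge0// => i _; exact: sqr_ge0.
Qed.

Let vb := vbound f beta x v m.

Let v_le t : 0 <= t -> enorm (v t) <= vb.
Proof.
move=> t0.
apply: (@velocity_bound R d f gamma c C beta Cf c0 cC b0 bC x v a dx dv m t fm gb _ t) => //.
by move=> r /andP[r0 _]; exact: ode.
Qed.

Let grad_le_n2 t : enorm (grad f (u t)) ^+ 2 <= n2 t.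
Proof.
rewrite enorm_sqr /n2 sqnorm_denergyE -/u (eq_bigr (fun i => pd f i (u t) ^+ 2)) => [|i _];
  last by rewrite mxE.
by rewrite lerDl sumr_ge0// => i _; exact: sqr_ge0.
Qed.

Let v_le_n2 t : enorm (v t) ^+ 2 <= n2 t.
Proof.
rewrite enorm_sqr /n2 sqnorm_denergyE lerDr sumr_ge0// => i _; exact: sqr_ge0.
Qed.

(** Integrating k n2 <= - V', with V bounded below by m, bounds the integral of n2. *)
Lemma L2_of_sqnorm_denergy (h : R -> 'rV[R]_d) (K : R) : continuous h -> 0 < K ->
  (forall t, 0 <= t -> enorm (h t) ^+ 2 <= K * n2 t) -> Lp_Rplus 2 h.
Proof.
move=> ch K0 hn; apply: (@Lp_Rplus_bound R d 2 h ((V 0 - m) / (k / K))) => //.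
apply: (@primitive_le R _ V V') => //.
- by apply: continuous_sqr; exact: enorm_continuous.
- exact: divr_gt0.
- move=> t t0; apply: le_trans (V'_le t0).
  by rewrite mulrAC -mulrA ler_pM2l// ler_pdivrMr// mulrC hn// ltW.
Qed.

Lemma velocity_L2 : Lp_Rplus 2 v.
Proof. by apply: (@L2_of_sqnorm_denergy v 1) => // t _; rewrite mul1r. Qed.

Let cgrad (y : R -> 'rV[R]_d) : continuous y -> continuous (fun t => grad f (y t)).
Proof. by move=> cy; exact: (continuous_funcomp cy (grad_continuous Cf)). Qed.

Lemma gradient_L2 : Lp_Rplus 2 (fun t => grad f (u t)).
Proof.
apply: (L2_of_sqnorm_denergy (cgrad cu) ltr01) => t _; rewrite mul1r; exact: grad_le_n2.
Qed.

(** * Bounded trajectories *)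

Variable M : R.
Hypothesis xM : forall t, 0 <= t -> enorm (x t) <= M.

Let vb0 : 0 <= vb. Proof. exact: sqrtr_ge0. Qed.
Let M0 : 0 <= M. Proof. by apply: le_trans (xM (lexx 0)); exact: enorm_ge0. Qed.
Let B := M + beta * vb + vb.

Let x_le t : 0 <= t -> `|x t| <= M.
Proof. by move=> t0; apply: le_trans (norm_le_enorm _) (xM t0). Qed.
Let v_le' t : 0 <= t -> `|v t| <= vb.
Proof. by move=> t0; apply: le_trans (norm_le_enorm _) (v_le t0). Qed.
Let u_le t : 0 <= t -> `|u t| <= M + beta * vb.
Proof.
move=> t0; apply: le_trans (ler_normD _ _) _; apply: lerD; first exact: x_le.
by rewrite normrZ gtr0_norm// ler_pM2l//; exact: v_le'.
Qed.
Let bvb0 : 0 <= beta * vb. Proof. by rewrite mulr_ge0// ltW. Qed.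
Let z_le t : 0 <= t -> `|z t| <= B.
Proof.
move=> t0; apply: norm_row_mx.
  by apply: le_trans (u_le t0) _; rewrite lerDl.
by apply: le_trans (v_le' t0) _; rewrite lerDr addr_ge0.
Qed.

Let lipb_v i : bounded_lipschitz (fun t => v t 0 i).
Proof.
have [G G0 HG] := bounded_on_ball (M + beta * vb) (Cf.2 i).
apply: (@bounded_lipschitz_derive R _ (fun t => a t 0 i) vb (C * vb + G)).
- by move=> t t0; apply: le_trans (coord_le_norm _ _) (v_le' t0).
move=> t t0; have := congr1 (fun w : 'rV[R]_d => w 0 i) (ode t0); rewrite !mxE => E.
have -> : a t 0 i = - (gamma t * v t 0 i) - pd f i (u t) by rewrite -/u in E; lra.
apply: le_trans (ler_normB _ _) _; apply: lerD; last exact/HG/u_le/ltW.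
rewrite normrN normrM; have /andP[g1 g2] := gb (ltW t0).
rewrite ger0_norm; last by apply: le_trans g1; exact: ltW.
apply: ler_pM => //; first by apply: le_trans g1; exact: ltW.
by apply: le_trans (coord_le_norm _ _) (v_le' (ltW t0)).
Qed.

Let lipb_x i : bounded_lipschitz (fun t => x t 0 i).
Proof.
apply: (@bounded_lipschitz_derive R _ (fun t => v t 0 i) M vb).
- by move=> t t0; apply: le_trans (coord_le_norm _ _) (x_le t0).
- by move=> t t0; apply: le_trans (coord_le_norm _ _) (v_le' (ltW t0)).
Qed.

Lemma bounded_lipschitz_shifted i : bounded_lipschitz (fun t => u t 0 i).
Proof.
have [K1 K10 [h1 h2]] := lipb_x i; have [K2 K20 [h3 h4]] := lipb_v i.
have bK : 0 <= beta * K2 by rewrite mulr_ge0// ltW.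
exists (K1 + beta * K2); first exact: addr_ge0.
split => [t t0|s t s0 t0].
  rewrite !mxE; apply: le_trans (ler_normD _ _) _; apply: lerD; first exact: h1.
  by rewrite normrM gtr0_norm// ler_pM2l//; exact: h3.
rewrite (_ : _ - _ = (x s 0 i - x t 0 i) + beta * (v s 0 i - v t 0 i)); last first.
  by rewrite !mxE; ring.
rewrite mulrDl; apply: le_trans (ler_normD _ _) _; apply: lerD; first exact: h2.
by rewrite normrM gtr0_norm// -mulrA ler_pM2l//; exact: h4.
Qed.

Lemma sqnorm_denergy_cvg0 : n2 t @[t --> +oo] --> (0 : R).
Proof.
have cn2 : continuous n2.
  rewrite (_ : n2 = fun t => \sum_i pd f i (u t) ^+ 2 + \sum_i v t 0 i ^+ 2); last first.
    by apply/funext => t; rewrite /n2 sqnorm_denergyE.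
  move=> t; apply: cvgD.
    apply: continuous_sum => i; apply: continuous_sqr.
    exact: (continuous_funcomp cu (Cf.2 i)).
  by apply: continuous_sum => i; apply: continuous_sqr; exact: continuous_coord.
have [K1 K10 [_ h1]] : bounded_lipschitz (fun t => \sum_i pd f i (u t) ^+ 2).
  apply: bounded_lipschitz_sum => i; apply: bounded_lipschitz_sqr.
  apply: (@bounded_lipschitz_comp R d (pd f i) u).
    exact: C2_C1_pd.
  exact: bounded_lipschitz_shifted.
have [K2 K20 [_ h2]] : bounded_lipschitz (fun t => \sum_i v t 0 i ^+ 2).
  by apply: bounded_lipschitz_sum => i; exact: bounded_lipschitz_sqr.
apply: (@barbalat R n2 (K1 + K2) ((V 0 - m) / k)) => //.
  move=> s t s0 t0; rewrite /n2 !sqnorm_denergyE -/u.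
  rewrite (_ : _ - _ = (\sum_i pd f i (u s) ^+ 2 - \sum_i pd f i (u t) ^+ 2) +
     (\sum_i v s 0 i ^+ 2 - \sum_i v t 0 i ^+ 2)); last by ring.
  rewrite mulrDl; apply: le_trans (ler_normD _ _) _.
  by apply: lerD; [exact: h1|exact: h2].
exact: (@primitive_le R _ V V').
Qed.

Lemma enorm_cvg0 (h : R -> 'rV[R]_d) (K : R) : 0 < K ->
  (forall t, 0 <= t -> enorm (h t) ^+ 2 <= K * n2 t) -> enorm (h t) @[t --> +oo] --> (0 : R).
Proof.
move=> K0 hn; apply/cvgrPdist_le => e e0.
have eK : 0 < e ^+ 2 / K by rewrite divr_gt0// exprn_gt0.
have /cvgrPdist_le/(_ _ eK)[A [_ HA]] := sqnorm_denergy_cvg0.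
exists (Num.max A 0); split; first exact: num_real.
move=> t; rewrite gt_max => /andP[At t0].
rewrite sub0r normrN ger0_norm ?enorm_ge0//.
rewrite -(ler_pXn2r (_ : 0 < 2)%N) ?nnegrE ?enorm_ge0 ?(ltW e0)//.
apply: le_trans (hn _ (ltW t0)) _; rewrite mulrC -ler_pdivlMr//.
by have := HA _ At; rewrite sub0r normrN; exact: le_trans (ler_norm _).
Qed.

(** The points x and x + beta x' differ by beta x', so their gradients differ by at most a multiple
    of |x'|, and n2 controls both |x'|^2 and the squared gradient at x + beta x'. *)
Lemma gradient_x_le : exists2 K : R, 0 < K &
  forall t, 0 <= t -> enorm (grad f (x t)) ^+ 2 <= K * n2 t.
Proof.
have [L L0 HL] := grad_lipschitz (M + beta * vb) (fun i => C2_C1_pd i Cf2).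
pose D := L * beta.
have D0 : 0 <= D ^+ 2 by exact: sqr_ge0.
have s0 : 0 <= \sum_(i < d) 2 * D ^+ 2 by apply: sumr_ge0 => i _; rewrite mulr_ge0.
exists (2 + \sum_(i < d) 2 * D ^+ 2) => [|t t0]; first by rewrite ltr_wpDr.
have diff i : `|pd f i (x t) - pd f i (u t)| <= D * enorm (v t).
  have := coord_le_norm (grad f (x t) - grad f (u t)) i; rewrite !mxE => h.
  apply: le_trans h _; apply: le_trans (HL _ _ (u_le t0) _) _.
    by apply: le_trans (x_le t0) _; rewrite lerDl.
  rewrite /D -mulrA ler_wpM2l// /u /shifted opprD addNKr normrN normrZ gtr0_norm//.
  by rewrite ler_pM2l//; exact: norm_le_enorm.
rewrite enorm_sqr mulrDl mulr_suml.
apply: (@le_trans _ _ (\sum_i (2 * pd f i (u t) ^+ 2 + 2 * D ^+ 2 * n2 t))).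
  apply: ler_sum => i _; rewrite mxE.
  have h : (pd f i (x t) - pd f i (u t)) ^+ 2 <= D ^+ 2 * n2 t.
    apply: (@le_trans _ _ ((D * enorm (v t)) ^+ 2)).
      rewrite ler_sqr_norm; apply: le_trans (diff i) (ler_norm _).
    by rewrite exprMn ler_wpM2l.
  (* This square equals 2 q^2 + 2 (p - q)^2 - p^2. *)
  have := sqr_ge0 (pd f i (x t) - 2 * pd f i (u t)); move: h; rewrite -mulrA.
  set p := pd f i (x t); set q := pd f i (u t); set r := D ^+ 2 * n2 t; nra.
rewrite big_split /= lerD2r -mulr_sumr ler_pM2l//.
have := grad_le_n2 t; rewrite enorm_sqr; apply: le_trans.
by apply: ler_sum => i _; rewrite mxE.
Qed.

Lemma energy_cvg : exists2 l : R, V t @[t --> +oo] --> l & forall t, 0 <= t -> l <= V t.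
Proof.
have [s t s0 st|t t0|l Hl] := @nondecr_bounded_cvgy R (fun t => - V t) (- m).
- by rewrite lerN2 V_nonincr.
- by rewrite lerN2 V_ge.
exists (- l).
  have -> : V = fun t => - - V t by apply/funext => t; rewrite opprK.
  exact: cvgN.
move=> t t0; rewrite lerNl; apply: (cvgr_to_ge Hl); exists t; split; first exact: num_real.
by move=> s /ltW ts; rewrite lerN2 V_nonincr.
Qed.

Lemma velocity_cvg0 : enorm (v t) @[t --> +oo] --> (0 : R).
Proof. by apply: (@enorm_cvg0 v 1) => // t _; rewrite mul1r. Qed.

(** The limit is that of the energy: |x'|^2 / 2 and f (x) - f (x + beta x') both tend to 0. *)
Lemma value_cvg : cvg (f (x t) @[t --> +oo]).
Proof.
have [l Hl _] := energy_cvg; apply/cvg_ex; exists l.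
have [L L0 HL] := lipschitz_on_ball (M + beta * vb) Cf.
have H1 : f (x t) - f (u t) @[t --> +oo] --> (0 : R).
  apply/cvgrPdist_le => e e0.
  have Lb : 0 < L * beta + 1 by rewrite ltr_wpDl// mulr_ge0// ltW.
  have eL : 0 < e / (L * beta + 1) by rewrite divr_gt0.
  have /cvgrPdist_le/(_ _ eL)[A [_ HA]] := velocity_cvg0.
  exists (Num.max A 0); split; first exact: num_real.
  move=> t; rewrite gt_max => /andP[At /ltW t0].
  rewrite sub0r normrN; apply: le_trans (HL _ _ (u_le t0) _) _.
    by apply: le_trans (x_le t0) _; rewrite lerDl.
  rewrite /u /shifted opprD addNKr normrN normrZ gtr0_norm//.
  have := HA _ At; rewrite sub0r normrN ger0_norm ?enorm_ge0// ler_pdivlMr// => h.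
  apply: le_trans h; rewrite mulrA [leLHS]mulrC; apply: ler_pM => //.
  - by rewrite mulr_ge0// ltW.
  - exact: norm_le_enorm.
  - by rewrite lerDl.
have H2 : (\sum_i v t 0 i ^+ 2) / 2 @[t --> +oo] --> (0 : R).
  rewrite (_ : (fun t => _) = fun t => enorm (v t) * enorm (v t) / 2); last first.
    by apply/funext => t; rewrite -expr2 enorm_sqr.
  rewrite -[0](mul0r (2^-1)) -{1}[0](mul0r 0).
  by apply: cvgMr_tmp; apply: cvgM; exact: velocity_cvg0.
have := cvgD (cvgB Hl H2) H1; rewrite subr0 addr0.
have -> : (fun t => f (x t)) =
    fun t => V t - (\sum_i v t 0 i ^+ 2) / 2 + (f (x t) - f (u t)).
  by apply/funext => t; rewrite /V energy_phaseE -/u; ring.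
exact.
Qed.

(** * Finite length and convergence for definable f *)

Section Definable.
Variable S : forall n : nat, set (set 'rV[R]_n).
Hypothesis HS : o_minimal_structure S.
Hypothesis df : dfun S f.

Let ce : continuous (fun t => enorm (v t)).
Proof. exact: enorm_continuous. Qed.

Let len := primitive (fun t => enorm (v t)).

Let len_nondecr s t : s <= t -> len s <= len t.
Proof. by apply: primitive_nondecr => // r; exact: enorm_ge0. Qed.

(** With n = |grad E (z)|, the energy decays at rate at least k n^2 and psi has slope about 1 / n or
    more, so psi along the trajectory drops at a rate comparable to n, hence to |x'| or more. The
    total drop of psi is bounded. *)
Lemma length_bounded : exists K, forall t, 0 <= t -> len t <= K.
Proof.
have [l Hl lV] := energy_cvg.
have [psi [eps [K [eps0 psi_nd psi_le KL]]]] := kurdyka_energy HS Cf df B l.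
have K0 : 0 <= K by apply: le_trans (psi_le _ (z_le (lexx 0))).
(* psi is extended below its values on the trajectory, to cover stationary trajectories *)
pose psi0 (s : R) := if s <= 0 then - K else psi s.
have /cvgrPdist_lt/(_ _ eps0)[A [_ HA]] := Hl.
pose T := Num.max A 0 + 1.
have T0 : 0 < T by rewrite ltr_wpDl// le_max lexx orbT.
have AT : A < T by rewrite (@le_lt_trans _ _ (Num.max A 0)) ?le_max ?lexx// ltrDl.
have small t : T <= t -> 0 <= V t - l < eps.
  move=> Tt; have t0 : 0 <= t by apply: le_trans Tt; exact: ltW.
  have := HA _ (lt_le_trans AT Tt); rewrite distrC ltr_norml => /andP[_ ->].
  by rewrite subr_ge0 lV.
pose h t := psi0 (V t - l).
have h_nonincr s t : T <= s -> s <= t -> h t <= h s.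
  move=> Ts st; have s0 : 0 <= s by apply: le_trans Ts; exact: ltW.
  have t0 : 0 <= t by exact: le_trans st.
  have Vts : V t - l <= V s - l by rewrite lerD2r V_nonincr.
  rewrite /h /psi0; case: (leP (V t - l) 0) => [_|Vt0].
    case: ifP => // _; have := psi_le _ (z_le s0); rewrite ler_norml => /andP[+ _]; exact.
  rewrite (lt_geF (lt_le_trans Vt0 Vts)); apply: psi_nd => //.
  by have /andP[] := small s Ts.
have h_le t : 0 <= t -> `|h t| <= K.
  move=> t0; rewrite /h /psi0; case: ifP => _; last exact/psi_le/z_le.
  by rewrite normrN ger0_norm.
(* At such a t the energy is minimal among its later values, so V' t >= 0, while V' t <= - k n2
   t. *)
have stationary t : 0 < t -> V t - l <= 0 -> n2 t = 0.
  move=> t0 Vtl; apply/eqP; rewrite eq_le n2_ge0 andbT -(pmulr_rle0 _ k_gt0).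
  apply: le_trans (V'_le t0) _; rewrite oppr_le0.
  apply/ler_addgt0Pr => e e0.
  have [dl dl0 Hdl] := (is_derive_distP V t (V' t)).1 (dV t) e e0.
  have := Hdl (t + dl / 2); rewrite (addrC t) addrK gtr0_norm ?divr_gt0// => /(_ ltac:(lra)).
  rewrite ler_norml => /andP[_ h1].
  have := lV (dl / 2 + t); rewrite addr_ge0 ?divr_ge0 ?(ltW dl0) ?(ltW t0)// => /(_ isT) h2.
  have h3 : 0 <= (V' t + e) * (dl / 2) by lra.
  by move: h3; rewrite pmulr_lge0// divr_gt0.
(* Half of the decay k n^2 is given up to the difference quotient, and a factor 2 to the choice e =
   n in the Kurdyka inequality, which leaves a drop of h at rate k n / 4. [lf] gains at most k n / 8
   plus an error of the same size. *)
pose lf t := k / 8 * len t.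
have dlf (t : R) : is_derive t 1 lf (k / 8 * enorm (v t)).
  have ? := is_derive_primitive t ce.
  by apply: is_derive_eq; rewrite /GRing.scale /=; ring.
have clf : continuous lf by move=> t; apply: is_derive_continuous; exact: dlf.
have dini t e : T <= t -> 0 < e -> exists2 dl : R, 0 < dl &
     forall s, t < s < t + dl -> h s + lf s - (h t + lf t) <= e * (s - t).
  move=> Tt e0; have t0 : 0 < t := lt_le_trans T0 Tt.
  (* If n2 t = 0 then x' vanishes at t and h cannot increase, so only the differentiation error of
     [lf] remains. *)
  have [n20|n2t] := eqVneq (n2 t) 0.
    have v0 : enorm (v t) = 0.
      apply/eqP; rewrite -(sqrf_eq0 (enorm (v t))) eq_le sqr_ge0 andbT.
      by rewrite -n20 v_le_n2.
    have [dl dl0 Hdl] := (is_derive_distP lf t _).1 (dlf t) e e0.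
    exists dl => // s /andP[ts sdl]; have := Hdl s; rewrite gtr0_norm ?subr_gt0//.
    rewrite ltrBlDl => /(_ sdl); rewrite v0 mulr0 mul0r subr0 => h1.
    by have := h_nonincr _ _ Tt (ltW ts); have := le_trans (ler_norm _) h1; lra.
  have n2t0 : 0 < n2 t by rewrite lt_neqAle eq_sym n2t n2_ge0.
  pose n := Num.sqrt (n2 t).
  have n0 : 0 < n by rewrite sqrtr_gt0.
  have nn : n * n = n2 t by rewrite -expr2 sqr_sqrtr.
  have vn : enorm (v t) <= n.
    rewrite -(ler_pXn2r (_ : 0 < 2)%N) ?nnegrE ?enorm_ge0 ?(ltW n0)//.
    by have -> : n ^+ 2 = n2 t by rewrite expr2 nn.
  have Vt0 : 0 < V t - l.
    rewrite ltNge; apply/negP => /(stationary _ t0) E; by rewrite E ltxx in n2t0.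
  have /andP[_ Vte] := small t Tt.
  have [|dl1 dl10 H1] := KL (z t) n (z_le (ltW t0)) _ n0; first by rewrite Vt0.
  have kn : 0 < k * n2 t / 2 by rewrite divr_gt0// mulr_gt0.
  have [dl2 dl20 H2] := (is_derive_distP V t _).1 (dV t) _ kn.
  (* The second bound keeps V s above l, where [psi0] agrees with psi. *)
  have mn0 : 0 < Num.min dl1 (V t - l) by rewrite lt_min dl10.
  have [dl3 dl30 H3] := (continuous_distP V t).1 (cV (x := t)) _ mn0.
  have kn8 : 0 < k / 8 * n by rewrite mulr_gt0// divr_gt0.
  have [dl4 dl40 H4] := (is_derive_distP lf t _).1 (dlf t) _ kn8.
  exists (Num.min (Num.min dl2 dl3) dl4); first by rewrite !lt_min dl20 dl30.
  move=> s /andP[ts]; rewrite -ltrBlDl !lt_min => /andP[/andP[s2 s3] s4].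
  have st0 : 0 < s - t by rewrite subr_gt0.
  have stE : `|s - t| = s - t by rewrite gtr0_norm.
  have := H2 s; have := H3 s; have := H4 s; rewrite stE => /(_ s4) {}H4 /(_ s3) {}H3 /(_ s2) {}H2.
  move: H3; rewrite distrC => /(le_lt_trans (ler_norm _)); rewrite lt_min => /andP[V1 V2].
  have s0 : 0 <= s by apply: ltW; exact: lt_trans ts.
  have Vs0 : 0 < V s - l by lra.
  have := H1 (z s) (z_le s0) Vs0 (V_nonincr (ltW t0) (ltW ts)) V1.
  rewrite -/(V t) -/(V s) -[Num.sqrt _]/n => {}H1.
  have hE : psi (V t - l) - psi (V s - l) = h t - h s.
    by rewrite /h /psi0 (lt_geF Vt0) (lt_geF Vs0).
  rewrite hE in H1.
  have Vdec : k * n2 t / 2 * (s - t) <= V t - V s.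
    have := le_trans (ler_norm _) H2; have := ler_wpM2r (ltW st0) (V'_le t0); lra.
  have h1 : k / 4 * n * (s - t) <= h t - h s.
    have n20' : 0 < n + n by lra.
    rewrite -(ler_pM2l n20'); apply: le_trans H1; apply: le_trans Vdec.
    rewrite -nn; lra.
  have h2 : lf s - lf t <= k / 4 * n * (s - t).
    have := le_trans (ler_norm _) H4.
    have : k / 8 * enorm (v t) * (s - t) <= k / 8 * n * (s - t).
      by rewrite ler_pM2r// ler_pM2l// divr_gt0.
    lra.
  by have := mulr_gt0 e0 st0; lra.
have final := dini_nonincr h_nonincr clf dini.
exists (len T + (2 * K) / (k / 8)) => t t0.
have k8 : 0 < k / 8 by rewrite divr_gt0.
have [Tt|/ltW tT] := leP T t; last first.
  by apply: le_trans (len_nondecr tT) _; rewrite lerDl divr_ge0 ?mulr_ge0// ltW.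
have := final t Tt; have := h_le t t0; have := h_le T (ltW T0).
rewrite !ler_norml /lf => /andP[p1 p2] /andP[p3 p4] p5.
by rewrite -(ler_pM2l k8) mulrDr (mulrC _ (2 * K / _)) divfK ?gt_eqF//; lra.
Qed.

Lemma velocity_L1 : Lp_Rplus 1 v.
Proof.
have [K HK] := length_bounded.
exact: (@Lp_Rplus_bound R d 1 v K).
Qed.

Lemma trajectory_cvg : exists2 w, critical f w & x t @[t --> +oo] --> w.
Proof.
have [K HK] := length_bounded.
have [l Hl] := @nondecr_bounded_cvgy R len K (fun s t _ st => len_nondecr st) HK.
have /choice[w Hw] : forall i, exists wi : R, x t 0 i @[t --> +oo] --> wi.
  move=> i.
  (* Adding the length, whose derivative is |x'|, makes the coordinate nondecreasing; the sum and
     the length are bounded, so both converge, and so does their difference. *)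
  have [s t s0 st|t t0|q Hq] := @nondecr_bounded_cvgy R (fun t => len t + x t 0 i) (K + M).
  - have dN (r : R) : is_derive r 1 (fun r => - x r 0 i) (- v r 0 i).
      by apply: is_deriveN; exact: dx.
    have cN : continuous (fun r => - x r 0 i).
      by move=> r; apply: is_derive_continuous; exact: dN.
    have le r : s < r < t -> - v r 0 i <= enorm (v r).
      by move=> _; apply: le_trans (coord_le_enorm _ i); rewrite -normrN ler_norm.
    have := derive_le st (fun r _ => dN r) (fun r _ => is_derive_primitive r ce) cN
      (primitive_continuous ce) le.
    by rewrite -/len; lra.
  - apply: lerD; first exact: HK.
    by apply: le_trans (ler_norm _) _; apply: le_trans (coord_le_norm _ _) (x_le t0).
  exists (q - l).
  have -> : (fun t => x t 0 i) = fun t => len t + x t 0 i - len t.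
    by apply/funext => t; rewrite addrC addKr.
  exact: cvgB Hq Hl.
pose ww : 'rV[R]_d := \row_i w i.
have xw : x t @[t --> +oo] --> ww.
  by apply: cvg_row => i; rewrite mxE; exact: Hw.
exists ww => //; apply: enorm0_eq0.
have [Kg Kg0 HKg] := gradient_x_le.
have g0 := enorm_cvg0 Kg0 HKg.
have cgw := @enorm_continuous R _ d (grad f) (grad_continuous Cf).
have g1 : enorm (grad f (x t)) @[t --> +oo] --> enorm (grad f ww).
  exact: (cvg_comp x (fun w => enorm (grad f w)) xw (cgw ww)).
exact: cvg_unique g1 g0.
Qed.

End Definable.
End Trajectory.

Theorem mainTheorem10 (R : realType) (d : nat) (f : 'rV[R]_d -> R)
  (gamma : R -> R) (c C beta : R) (x0 v0 : 'rV[R]_d) :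
  C2 f ->
  (exists m : R, forall u, m <= f u) ->
  {within @Rplus R, continuous gamma} ->
  0 < c -> c <= C ->
  (forall t, 0 <= t -> c <= gamma t <= C) ->
  0 < beta -> beta < 2 * c / C ^+ 2 ->
  (* (i) global existence *)
  (exists x : R -> 'rV[R]_d, ISIHD_solution f gamma beta x0 v0 x) /\
  (forall x : R -> 'rV[R]_d, ISIHD_solution f gamma beta x0 v0 x ->
    (* (ii) *)
    [/\ Lp_Rplus 2 (vel x),
        Lp_Rplus 2 (fun t => grad f (x t + beta *: vel x t)) &
    (* (iii) *)
        ((exists M : R, forall t, 0 <= t -> enorm (x t) <= M) ->
         [/\ Lp_Rplus 2 (fun t => grad f (x t)),
             enorm (grad f (x t)) @[t --> +oo] --> 0,
             enorm (vel x t) @[t --> +oo] --> 0,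
             cvg (f (x t) @[t --> +oo]) &
    (* (iv) *)
             (definable f ->
                Lp_Rplus 1 (vel x) /\
                exists2 u, critical f u & x t @[t --> +oo] --> u)])]).
Proof.
move=> Cf2 [m fm] cg c0 cC gb b0 bC; split.
  exact: (ISIHD_existence x0 v0 Cf2 fm cg c0 cC gb b0 bC).
move=> x [Cx ode _ _].
have dx (t : R) i : is_derive t 1 (fun s => x s 0 i) (vel x t 0 i).
  by rewrite mxE; have [d1 _ _] := Cx i; exact: derivable_is_derive1.
have dv (t : R) i : is_derive t 1 (fun s => vel x s 0 i) (acc x t 0 i).
  rewrite (_ : (fun s => _) = derive1 (fun s => x s 0 i)); last first.
    by apply/funext => s; rewrite mxE.
  by rewrite mxE; have [_ d2 _] := Cx i; exact: derivable_is_derive1.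
split.
- exact: (velocity_L2 Cf2 fm c0 cC gb b0 bC dx dv ode).
- exact: (gradient_L2 Cf2 fm c0 cC gb b0 bC dx dv ode).
move=> [M xM].
have [K K0 HK] := gradient_x_le Cf2 fm c0 cC gb b0 bC dx dv ode xM.
split.
- apply: (L2_of_sqnorm_denergy Cf2 fm c0 cC gb b0 bC dx dv ode _ K0 HK).
  exact: (continuous_funcomp (x_continuous dx) (grad_continuous (C2_C1 Cf2))).
- exact: (enorm_cvg0 Cf2 fm c0 cC gb b0 bC dx dv ode xM K0 HK).
- exact: (velocity_cvg0 Cf2 fm c0 cC gb b0 bC dx dv ode xM).
- exact: (value_cvg Cf2 fm c0 cC gb b0 bC dx dv ode xM).
move=> [S [HS /(dfun_of_definable HS) df]]; split.
  exact: (velocity_L1 Cf2 fm c0 cC gb b0 bC dx dv ode xM HS df).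
exact: (trajectory_cvg Cf2 fm c0 cC gb b0 bC dx dv ode xM HS df).
Qed.
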